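(* Let $\mathcal{S}$ be the family of univalent (i.e. one-to-one) holomorphic maps $f:D_1\to\mathbb{C}$ satisfying $f(0)=0$ and $f'(0)=1$. Then $\mathcal{S}$ is compact in $\mathcal{H}(D_1)$.
   Context: $D_1$ is the open unit disk in $\mathbb{C}$, and $\mathcal{H}(D_1)$ is the space of holomorphic functions on $D_1$, with the topology of locally uniform convergence. *)

(* Defs.v *)
From HB Require Import structures.
From mathcomp Require Import all_boot all_order all_algebra complex.
From mathcomp Require Import all_classical all_reals topology normedtype derive.

Set Implicit Arguments.
Unset Strict Implicit.
Unset Printing Implicit Defensive.

Import Order.TTheory GRing.Theory Num.Theory.
Import numFieldNormedType.Exports.

Local Open Scope classical_set_scope.
Local Open Scope ring_scope.

(* The norm topology is attached to the regular module [R[i]^o], not to [R[i]]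
   itself. Scalars range over [R[i]], so that [derivable _ _ 1] on
   [Cplx R -> Cplx R] is complex differentiability. *)
Notation Cplx R := ((R[i]%C)^o).

Definition unit_disk (R : realType) : set (Cplx R) := [set z | `|z| < 1].
Arguments unit_disk R : clear implicits.

(* Functions live on the subtype [unit_disk R]; derivatives are those of the
   extension by 0. As the disk is open, the extension does not affect
   derivatives at points of the disk. *)
Definition disk_ext (R : realType) (f : unit_disk R -> Cplx R) :
  Cplx R -> Cplx R := 'valL_0 f.

(* [{family compact, U -> V}] carries the topology of uniform convergence on
   compact subsets of [U]; the disk being locally compact, this is the topology
   of locally uniform convergence. *)
Definition holomorphic_on_disk (R : realType) :
    set {family compact, unit_disk R -> Cplx R} :=
  [set f | forall z, unit_disk R z -> derivable (disk_ext f) z 1].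
Arguments holomorphic_on_disk R : clear implicits.

Definition hol_disk (R : realType) : Type := set_type (holomorphic_on_disk R).
HB.instance Definition _ (R : realType) :=
  Uniform.copy (hol_disk R) (set_type (holomorphic_on_disk R)).

Definition hol_fun (R : realType) (f : hol_disk R) : unit_disk R -> Cplx R :=
  set_val f.

Definition schlicht (R : realType) : set (hol_disk R) :=
  [set f | [/\ injective (hol_fun f),
               disk_ext (hol_fun f) 0 = 0
             & 'D_1 (disk_ext (hol_fun f)) 0 = 1]].
Arguments schlicht R : clear implicits.

(* Main.v *)
Require Import Defs.
From mathcomp Require Import all_boot all_order all_algebra complex ring lra.
From mathcomp Require Import all_classical all_reals topology normedtype derive.
From mathcomp Require Import sequences exp trigo.

(** Compactness is tested on ultrafilters.  Let an ultrafilter contain the class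
    S.  The functions of S are bounded on every disk of radius r < 1 by a
    constant depending on r only ([growth]), so by Cauchy's estimates each
    Taylor coefficient is bounded on S and converges along the ultrafilter; the
    power series of the limit coefficients converges in the unit disk, and the
    tails of all the series are dominated by one geometric series, hence the
    convergence is locally uniform ([univalent_ultra_limit]).  The limit keeps
    the first two coefficients 0 and 1, so it is not constant, and it is
    injective by Hurwitz's theorem ([hurwitz]).

    Local boundedness is obtained without the area theorem.  Given f in S and
    r < 1, let w0 = f z0 have the least modulus among the values of f on the
    circle of radius r.  The maximum principle for z / f z gives |w0| <= 1
    and |f z| >= |w0| |z| / r inside ([omitted_value]).  As f misses w0 on
    the smaller disk, h = sqrt (1 - f (r z) / w0) exists; the squares of its
    values determine z, so h never takes both a value and its opposite, and
    since it covers a disk about h 0 = 1 it omits a disk about -1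
    ([sqrt_transform]).  Then (h + 1) / 2 is bounded away from 0, and the
    Borel-Caratheodory argument applied to its logarithm bounds it above
    ([caratheodory_bound]).

    The function theory behind this, for functions that are only assumed
    differentiable at each point, uses no integral.  Trapezoid sums [tsum] on
    dyadically bisected segments are exactly additive under bisection, exact on
    affine functions and bounded by the sup norm times the length, which is
    all that Goursat's subdivision argument needs: the sums over the sides of a
    triangle tend to 0 ([goursat]), also when the function is merely bounded
    near one vertex ([goursat_corner]).  For f composed with the exponential, a
    rectangle of height 2 pi is an annulus cut open, and Goursat's lemma says
    that the means [vmean] of f over concentric circles agree asymptotically.
    Applied to (f w - f z) w / (w - z), this is Cauchy's formula
    ([cauchy_null]); limits of the means of f w / w^k along an ultrafilter on
    the integers are the Taylor coefficients ([taylor]).  Derivatives,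
    primitives, logarithms, the maximum principle and Schwarz's lemma follow
    by computing with power series. *)

Set Implicit Arguments.
Unset Strict Implicit.
Unset Printing Implicit Defensive.

Import Order.TTheory GRing.Theory Num.Theory Normc.
Import numFieldNormedType.Exports.

Local Open Scope classical_set_scope.
Local Open Scope ring_scope.

(** * Modulus, and limits along a filter *)

Section Modulus.
Variable R : realType.
Local Notation C := R[i].
Implicit Types (z w : C) (x y : R).

Lemma normcE_norm z : `|z| = ((normc z)%:C)%C.
Proof. by case: z. Qed.

Lemma normc_ge0 z : 0 <= normc z.
Proof. by case: z => a b; rewrite sqrtr_ge0. Qed.

Lemma normc_eq0 z : (normc z == 0) = (z == 0).
Proof.
by apply/eqP/eqP => [/eq0_normc//|->]; rewrite normc0.
Qed.

Lemma normc_gt0 z : (0 < normc z) = (z != 0).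
Proof. by rewrite lt_neqAle normc_ge0 andbT eq_sym normc_eq0. Qed.

Lemma ler_normcD z w : normc (z + w) <= normc z + normc w.
Proof. exact: le_normcD. Qed.

Lemma normc_opp z : normc (- z) = normc z.
Proof. exact: normcN. Qed.

Lemma normcBC z w : normc (z - w) = normc (w - z).
Proof. by rewrite -opprB normc_opp. Qed.

Lemma ler_normcB z w : normc (z - w) <= normc z + normc w.
Proof. by rewrite -(normc_opp w); exact: ler_normcD. Qed.

Lemma ler_normc_tri v z w : normc (z - w) <= normc (z - v) + normc (v - w).
Proof. by rewrite -{1}(subrK v z) -addrA ler_normcD. Qed.

Lemma lerB_normc z w : normc z - normc w <= normc (z - w).
Proof. by rewrite lerBlDr; have := ler_normcD (z - w) w; rewrite subrK. Qed.

Lemma normcX z n : normc (z ^+ n) = normc z ^+ n.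
Proof. by elim: n => [|n IH]; rewrite ?expr0 ?normc1 // !exprS normcM IH. Qed.

Lemma normc_real x : normc (x%:C)%C = `|x|.
Proof. by rewrite /= expr0n /= addr0 sqrtr_sqr. Qed.

Lemma normcZi x : normc (0 +i* x)%C = `|x|.
Proof. by rewrite /= expr0n /= add0r sqrtr_sqr. Qed.

Lemma normc_nat n : normc (n%:R : C) = n%:R.
Proof. by rewrite -(rmorph_nat (real_complex R)) normc_real ger0_norm ?ler0n. Qed.

Lemma normc_sum (I : Type) (r : seq I) (P : pred I) (F : I -> C) :
  normc (\sum_(i <- r | P i) F i) <= \sum_(i <- r | P i) normc (F i).
Proof.
elim/big_rec2: _ => [|i x z _ H]; first by rewrite normc0.
by apply: le_trans (ler_normcD _ _) _; rewrite lerD2l.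
Qed.

Lemma normc_sqr z : normc z ^+ 2 = complex.Re z ^+ 2 + complex.Im z ^+ 2.
Proof. by case: z => a b; rewrite sqr_sqrtr ?addr_ge0 ?sqr_ge0. Qed.

Lemma Re_le_normc z : `|complex.Re z| <= normc z.
Proof.
rewrite -(@ler_pXn2r _ 2) ?nnegrE ?normc_ge0 // normc_sqr real_normK ?num_real //.
by rewrite lerDl sqr_ge0.
Qed.

Lemma Im_le_normc z : `|complex.Im z| <= normc z.
Proof.
rewrite -(@ler_pXn2r _ 2) ?nnegrE ?normc_ge0 // normc_sqr real_normK ?num_real //.
by rewrite lerDr sqr_ge0.
Qed.

Lemma normc_le_ReIm z : normc z <= `|complex.Re z| + `|complex.Im z|.
Proof.
case: z => a b.
have -> : (a +i* b)%C = (a%:C)%C + (0 +i* b)%C :> C.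
  by rewrite /GRing.add /= addr0 add0r.
apply: le_trans (ler_normcD _ _) _.
by rewrite normc_real normcZi /= add0r addr0.
Qed.

End Modulus.

Section Limits.
Variable R : realType.
Local Notation C := R[i].

(** One notion for sequences, for limits at a point and for limits along
    ultrafilters: only the filter changes, so the algebra of limits is proved
    once. *)
Definition clim (T : Type) (F : set_system T) (u : T -> C) (l : C) :=
  forall e : R, 0 < e -> F [set x | normc (u x - l) < e].

Section Filter.
Variables (T : Type) (F : set_system T).
Context {FF : Filter F}.
Implicit Types (u v : T -> C) (l m : C).

Lemma clim_cst l : clim F (fun=> l) l.
Proof. by move=> e e0; apply: filterE => x /=; rewrite subrr normc0. Qed.

Lemma clim_near_eq u v l : F [set x | u x = v x] -> clim F u l -> clim F v l.
Proof. by move=> uv ul e /ul; apply: filterS2 uv => x /= ->. Qed.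

Lemma climD u v l m :
  clim F u l -> clim F v m -> clim F (fun x => u x + v x) (l + m).
Proof.
move=> ul vm e e0; have e2 : 0 < e / 2 by lra.
apply: filterS2 (ul _ e2) (vm _ e2) => x /= a b.
have -> : u x + v x - (l + m) = (u x - l) + (v x - m) by ring.
by have := ler_normcD (u x - l) (v x - m); lra.
Qed.

Lemma climN u l : clim F u l -> clim F (fun x => - u x) (- l).
Proof.
move=> ul e /ul; apply: filterS => x /=.
by rewrite -opprD normc_opp.
Qed.

Lemma climB u v l m :
  clim F u l -> clim F v m -> clim F (fun x => u x - v x) (l - m).
Proof. by move=> ul vm; apply: climD => //; apply: climN. Qed.

Lemma climM u v l m :
  clim F u l -> clim F v m -> clim F (fun x => u x * v x) (l * m).
Proof.
move=> ul vm e e0; have l0 := normc_ge0 l; have m0 := normc_ge0 m.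
pose k := 2 + normc l + normc m; have k0 : 0 < k by rewrite /k; lra.
have d0 : 0 < Num.min 1 (e / k) by rewrite lt_min ltr01 divr_gt0.
apply: filterS2 (ul _ d0) (vm _ d0) => x /=.
rewrite !lt_min !ltr_pdivlMr // => /andP[a1 a2] /andP[b1 b2].
have -> : u x * v x - l * m =
  (u x - l) * (v x - m) + (l * (v x - m) + m * (u x - l)) by ring.
apply: le_lt_trans (ler_normcD _ _) _; rewrite normcM.
have := ler_normcD (l * (v x - m)) (m * (u x - l)); rewrite !normcM.
move: a1 a2 b1 b2; have := normc_ge0 (u x - l); have := normc_ge0 (v x - m).
rewrite /k; move: (normc (u x - l)) (normc (v x - m)) => a b; nra.
Qed.

Lemma clim_sum (I : Type) (r : seq I) (P : pred I) (u : I -> T -> C) (l : I -> C) :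
  (forall i, P i -> clim F (u i) (l i)) ->
  clim F (fun x => \sum_(i <- r | P i) u i x) (\sum_(i <- r | P i) l i).
Proof.
move=> ul; elim: r => [|i r IH].
  rewrite big_nil; apply: (@clim_near_eq (fun=> 0)); last exact: clim_cst.
  by apply: filterE => x /=; rewrite big_nil.
rewrite big_cons; case: ifPn => Pi.
  apply: (@clim_near_eq (fun x => u i x + \sum_(i <- r | P i) u i x)).
    by apply: filterE => x /=; rewrite big_cons Pi.
  by apply: climD => //; apply: ul.
apply: (@clim_near_eq (fun x => \sum_(i <- r | P i) u i x)) => //.
by apply: filterE => x /=; rewrite big_cons (negbTE Pi).
Qed.

Lemma climV u l : l != 0 -> clim F u l -> clim F (fun x => (u x)^-1) l^-1.
Proof.
move=> ln ul e e0; have l0 : 0 < normc l by rewrite normc_gt0.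
have d0 : 0 < Num.min (normc l / 2) (e * normc l * normc l / 2).
  by rewrite lt_min !divr_gt0 ?mulr_gt0.
apply: filterS (ul _ d0) => x /=; rewrite lt_min => /andP[a1 a2].
have ux : normc l / 2 < normc (u x) by have := lerB_normc l (u x); rewrite (normcBC l); lra.
have u0 : u x != 0 by rewrite -normc_gt0; lra.
have -> : (u x)^-1 - l^-1 = (l - u x) / (u x * l) by field; rewrite u0 ln.
have ux0 : 0 < normc (u x) by lra.
rewrite normcM normcV normcM normcBC ltr_pdivrMr ?mulr_gt0 //.
apply: lt_le_trans a2 _.
have := ler_wpM2l (ltW (mulr_gt0 e0 l0)) (ltW ux); lra.
Qed.

Lemma clim_ccomp (f : C -> C) u l :
  (forall e : R, 0 < e -> exists2 d : R, 0 < d &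
     forall w, normc (w - l) < d -> normc (f w - f l) < e) ->
  clim F u l -> clim F (f \o u) (f l).
Proof.
move=> fc ul e /fc[d d0 H]; apply: filterS (ul _ d0) => x /=; exact: H.
Qed.

End Filter.

Section ProperFilter.
Variables (T : Type) (F : set_system T).
Context {FF : ProperFilter F}.

Lemma clim_unique (u : T -> C) l m : clim F u l -> clim F u m -> l = m.
Proof.
move=> ul um; apply/eqP; rewrite -subr_eq0 -normc_eq0 eq_le normc_ge0 andbT.
apply/ler_addgt0Pr => e e0; have e2 : 0 < e / 2 by lra.
have [x /= [a b]] := @filter_ex _ _ FF _ (filterI (ul _ e2) (um _ e2)).
rewrite add0r; have := ler_normc_tri (u x) l m; rewrite (normcBC l (u x)); lra.
Qed.

Lemma clim_le (u : T -> C) l (M : R) :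
  F [set x | normc (u x) <= M] -> clim F u l -> normc l <= M.
Proof.
move=> uM ul; apply/ler_addgt0Pr => e e0.
have [x /= [a b]] := @filter_ex _ _ FF _ (filterI uM (ul _ e0)).
by have := lerB_normc l (u x); rewrite (normcBC l); lra.
Qed.

End ProperFilter.

Lemma ultra_real (T : Type) (F : set_system T) (u : T -> R) (M : R) :
  UltraFilter F -> F [set x | `|u x| <= M] ->
  exists l : R, forall e : R, 0 < e -> F [set x | `|u x - l| < e].
Proof.
move=> FU FM.
have [|l [_ ul]] := @segment_compact R (- M) M (u @ F) _.
  by apply: (@filterS _ F _ [set x | `|u x| <= M]) FM => x /=; rewrite ler_norml in_itv.
exists l => e e0; have [//|nFA] := in_ultra_setVsetC [set x | `|u x - l| < e] FU.
have [] := ul (u @` (~` [set x | `|u x - l| < e])) (ball l e).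
- by apply: (@filterS _ F _ _ _ _ nFA) => x Ax; exists x.
- exact: nbhsx_ballx.
by move=> _ [[x Ax <-]]; rewrite /ball /= distrC => /Ax.
Qed.

(** Compactness in the form used everywhere below: along an ultrafilter every
    bounded function has a limit, with no subsequence to extract. *)
Lemma ultra_clim (T : Type) (F : set_system T) (u : T -> C) (M : R) :
  UltraFilter F -> F [set x | normc (u x) <= M] -> exists l, clim F u l.
Proof.
move=> FU FM.
have [a ua] := @ultra_real _ F (fun x => complex.Re (u x)) M FU
  (filterS (fun x (H : normc (u x) <= M) => le_trans (Re_le_normc (u x)) H) FM).
have [b ub] := @ultra_real _ F (fun x => complex.Im (u x)) M FU
  (filterS (fun x (H : normc (u x) <= M) => le_trans (Im_le_normc (u x)) H) FM).
exists (a +i* b)%C => e e0; have e2 : 0 < e / 2 by lra.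
apply: filterS2 (ua _ e2) (ub _ e2) => x /= Ha Hb.
apply: le_lt_trans (normc_le_ReIm _) _.
by case: (u x) Ha Hb => p q /=; lra.
Qed.

End Limits.

(** * Complex differentiability *)

Section ComplexDerivative.
Variable R : realType.
Local Notation C := R[i].
Implicit Types (f g : C -> C) (z w d : C).

Definition cnear z : set_system C :=
  [set A | exists2 e : R, 0 < e & forall w, normc (w - z) < e -> A w].

#[global] Instance cnear_filter z : ProperFilter (cnear z).
Proof.
apply: Build_ProperFilter_ex; first by move=> A [e e0 /(_ z)]; rewrite subrr normc0 => /(_ e0) ?; exists z.
split; first by exists 1.
  move=> A B [a a0 HA] [b b0 HB]; exists (Num.min a b); first by rewrite lt_min a0.
  by move=> w; rewrite lt_min => /andP[/HA ? /HB ?].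
by move=> A B AB [e e0 H]; exists e => // w /H/AB.
Qed.

Lemma cnear_lt z (e : R) : 0 < e -> cnear z [set w | normc (w - z) < e].
Proof. by move=> e0; exists e. Qed.

Lemma cnearW z (A : set C) : cnear z A -> A z.
Proof. by move=> [e e0 /(_ z)]; rewrite subrr normc0; exact. Qed.

Definition ccont f z := clim (cnear z) f (f z).

Lemma ccont_id z : ccont id z.
Proof. by move=> e e0; exact: cnear_lt. Qed.

Lemma ccont_ex f z : ccont f z -> forall e : R, 0 < e -> exists2 d : R, 0 < d &
  forall w, normc (w - z) < d -> normc (f w - f z) < e.
Proof. by move=> fc e /fc. Qed.

Lemma clim_comp (T : Type) (F : set_system T) {FF : Filter F} f (u : T -> C) l :
  ccont f l -> clim F u l -> clim F (f \o u) (f l).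
Proof. by move=> /ccont_ex fc; exact: clim_ccomp. Qed.

Lemma ccont_near_neq0 f z : ccont f z -> f z != 0 -> cnear z [set w | f w != 0].
Proof.
rewrite -normc_gt0 => fc f0; apply: filterS (fc _ f0) => w /=.
by rewrite -normc_gt0 normcBC => H; have := lerB_normc (f z) (f w); lra.
Qed.

(** Differentiability with the error term cleared of denominators, so that
    [w = z] needs no exception. *)
Definition hasd f z d :=
  forall e : R, 0 < e ->
    cnear z [set w | normc (f w - f z - d * (w - z)) <= e * normc (w - z)].

(** Caratheodory's form of differentiability turns the rules of calculus into
    the algebra of limits. *)
Lemma hasdP f z d :
  hasd f z d <-> exists phi, [/\ phi z = d, ccont phi z &
    cnear z [set w | f w - f z = phi w * (w - z)]].
Proof.
split=> [H|[phi [<- phic H]] e e0]; last first.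
  apply: filterS2 H (phic _ e0) => w /= -> He.
  by rewrite -mulrBl normcM ler_wpM2r ?normc_ge0 ?ltW.
exists (fun w => if w == z then d else (f w - f z) / (w - z)); split.
- by rewrite eqxx.
- move=> e e0; have e2 : 0 < e / 2 by lra.
  apply: filterS (H _ e2) => w /=; rewrite eqxx; case: eqVneq => [_ _|wz].
    by rewrite subrr normc0.
  have wz0 : w - z != 0 by rewrite subr_eq0.
  have -> : (f w - f z) / (w - z) - d = (f w - f z - d * (w - z)) / (w - z).
    by field.
  have p := wz0; rewrite -normc_gt0 in p.
  by rewrite normcM normcV ltr_pdivrMr // => /le_lt_trans; apply; nra.
- apply: filterE => w /=; case: eqVneq => [->|wz]; first by rewrite !subrr mulr0.
  by rewrite divfK // subr_eq0.
Qed.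

Lemma hasd_cont f z d : hasd f z d -> ccont f z.
Proof.
move=> /hasdP[phi [_ phic H]].
have : clim (cnear z) (fun w => f z + phi w * (w - z)) (f z + phi z * (z - z)).
  apply: climD; first exact: clim_cst.
  apply: climM => //; apply: climB; [exact: ccont_id|exact: clim_cst].
rewrite subrr mulr0 addr0; apply: clim_near_eq.
by apply: filterS H => w /= <-; ring.
Qed.

Lemma hasd_near_eq f g z d : cnear z [set w | f w = g w] -> hasd f z d -> hasd g z d.
Proof.
move=> fg H e e0; have /= fgz := cnearW fg.
by apply: filterS2 fg (H _ e0) => w /= <-; rewrite fgz.
Qed.

Lemma hasd_cst (c : C) z : hasd (fun=> c) z 0.
Proof.
move=> e e0; apply: filterE => w /=.
by rewrite subrr mul0r subrr normc0 mulr_ge0 ?normc_ge0 ?ltW.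
Qed.

Lemma hasd_id z : hasd id z 1.
Proof.
move=> e e0; apply: filterE => w /=.
by rewrite mul1r subrr normc0 mulr_ge0 ?normc_ge0 ?ltW.
Qed.

Lemma hasdD f g z d e : hasd f z d -> hasd g z e -> hasd (fun w => f w + g w) z (d + e).
Proof.
move=> /hasdP[p [<- pc fp]] /hasdP[q [<- qc gq]]; apply/hasdP.
exists (fun w => p w + q w); split => //; first exact: climD.
by apply: filterS2 fp gq => w /= a b; rewrite mulrDl -a -b; ring.
Qed.

Lemma hasdM f g z d e : hasd f z d -> hasd g z e ->
  hasd (fun w => f w * g w) z (d * g z + f z * e).
Proof.
move=> Hf Hg; have gc := hasd_cont Hg.
move: Hf Hg => /hasdP[p [<- pc fp]] /hasdP[q [<- qc gq]]; apply/hasdP.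
exists (fun w => p w * g w + f z * q w); split => //.
  apply: climD; first exact: climM.
  by apply: climM => //; exact: clim_cst.
apply: filterS2 fp gq => w /= a b.
have -> : (p w * g w + f z * q w) * (w - z) =
  g w * (p w * (w - z)) + f z * (q w * (w - z)) by ring.
by rewrite -a -b; ring.
Qed.

Lemma hasdZ f (c : C) z d : hasd f z d -> hasd (fun w => c * f w) z (c * d).
Proof. by move=> H; have := hasdM (hasd_cst c z) H; rewrite mul0r add0r. Qed.

Lemma hasdN f z d : hasd f z d -> hasd (fun w => - f w) z (- d).
Proof.
move=> /(hasdZ (-1)); rewrite mulN1r; apply: hasd_near_eq.
by apply: filterE => w /=; rewrite mulN1r.
Qed.

Lemma hasdB f g z d e : hasd f z d -> hasd g z e -> hasd (fun w => f w - g w) z (d - e).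
Proof. by move=> Hf Hg; apply: hasdD => //; apply: hasdN. Qed.

Lemma hasdV f z d : f z != 0 -> hasd f z d ->
  hasd (fun w => (f w)^-1) z (- d / (f z) ^+ 2).
Proof.
move=> f0 Hf; have fc := hasd_cont Hf; have fn := ccont_near_neq0 fc f0.
move: Hf => /hasdP[p [<- pc fp]]; apply/hasdP.
exists (fun w => - p w / (f w * f z)); split; first by rewrite expr2.
  apply: climM; first exact: climN.
  by apply: climV; [rewrite mulf_neq0|apply: climM => //; exact: clim_cst].
apply: filterS2 fp fn => w /= a fw.
have -> : - p w / (f w * f z) * (w - z) = - (p w * (w - z)) / (f w * f z) by ring.
by rewrite -a; field; rewrite fw f0.
Qed.

Lemma hasd_comp f g z d e : hasd f z d -> hasd g (f z) e -> hasd (g \o f) z (e * d).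
Proof.
move=> Hf; have fc := hasd_cont Hf.
move: Hf => /hasdP[p [<- pc fp]] /hasdP[q [<- qc [r r0 gq]]]; apply/hasdP.
exists (fun w => q (f w) * p w); split => //.
  by apply: climM => //; exact: (clim_comp qc fc).
apply: filterS2 fp (fc _ r0) => w /= a b; rewrite gq // a; ring.
Qed.

Lemma hasd_unique f z d e : hasd f z d -> hasd f z e -> d = e.
Proof.
move=> Hd He; apply/eqP; rewrite -subr_eq0 -normc_eq0 eq_le normc_ge0 andbT.
apply/ler_addgt0Pr => a a0; rewrite add0r; have a2 : 0 < a / 2 by lra.
have [r r0 H] := filterI (Hd _ a2) (He _ a2).
pose w := z + ((r / 2)%:C)%C.
have wz : w - z = ((r / 2)%:C)%C by rewrite /w; ring.
have nr : normc (w - z) = r / 2 by rewrite wz normc_real ger0_norm; lra.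
have [] := H w; first by rewrite nr; lra.
rewrite /= nr => h1 h2.
have := ler_normc_tri (f w - f z) (d * (w - z)) (e * (w - z)).
rewrite -mulrBl normcM nr (normcBC (d * _)).
by move=> h3; rewrite -(ler_pM2r (_ : 0 < r / 2)); lra.
Qed.

Definition cdiff f z := exists d, hasd f z d.

Lemma cdiff_cont f z : cdiff f z -> ccont f z.
Proof. by case=> d /hasd_cont. Qed.

Lemma cdiff_near_eq f g z : cnear z [set w | f w = g w] -> cdiff f z -> cdiff g z.
Proof. by move=> fg [d H]; exists d; exact: hasd_near_eq H. Qed.

Lemma cdiff_cst (c : C) z : cdiff (fun=> c) z.
Proof. by exists 0; exact: hasd_cst. Qed.

Lemma cdiff_id z : cdiff id z.
Proof. by exists 1; exact: hasd_id. Qed.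

Lemma cdiffD f g z : cdiff f z -> cdiff g z -> cdiff (fun w => f w + g w) z.
Proof. by move=> [d Hd] [e He]; exists (d + e); exact: hasdD. Qed.

Lemma cdiffB f g z : cdiff f z -> cdiff g z -> cdiff (fun w => f w - g w) z.
Proof. by move=> [d Hd] [e He]; exists (d - e); exact: hasdB. Qed.

Lemma cdiffM f g z : cdiff f z -> cdiff g z -> cdiff (fun w => f w * g w) z.
Proof. by move=> [d Hd] [e He]; eexists; exact: hasdM Hd He. Qed.

Lemma cdiffV f z : f z != 0 -> cdiff f z -> cdiff (fun w => (f w)^-1) z.
Proof. by move=> f0 [d Hd]; eexists; exact: hasdV Hd. Qed.

Lemma cdiff_div f g z : g z != 0 -> cdiff f z -> cdiff g z -> cdiff (fun w => f w / g w) z.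
Proof. by move=> g0 Hf Hg; apply: cdiffM => //; exact: cdiffV. Qed.

Lemma cdiffX f n z : cdiff f z -> cdiff (fun w => f w ^+ n) z.
Proof.
move=> Hf; elim: n => [|n IH]; first exact: cdiff_cst.
by apply: cdiff_near_eq (cdiffM Hf IH); apply: filterE => w /=; rewrite exprS.
Qed.

Lemma cdiff_comp f g z : cdiff f z -> cdiff g (f z) -> cdiff (g \o f) z.
Proof. by move=> [d Hd] [e He]; eexists; exact: hasd_comp Hd He. Qed.

End ComplexDerivative.

(** * The complex exponential *)

Section ComplexExponential.
Variable R : realType.
Local Notation C := R[i].
Implicit Types (z w : C) (x y : R).

(** Serves to read off the first order expansions of exp, cos and sin at 0, out
    of which the complex one is assembled. *)
Lemma is_derive_eps (f : R -> R) x d : is_derive x 1 f d ->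
  forall e : R, 0 < e -> exists2 r : R, 0 < r &
    forall h, `|h| < r -> `|f (h + x) - f x - d * h| <= e * `|h|.
Proof.
move=> [df fd] e e0.
have := df; rewrite /derivable => /cvg_ex [l Hl].
have ld : l = d by rewrite -fd /derive; symmetry; exact: cvg_lim Hl.
have FF : Filter (0 : R)^' by exact: dnbhs_filter.
have HH := @cvgr_distC_le _ _ _ _ _ _ _ Hl _ e0; rewrite ld in HH.
have H' : nbhs (0 : R)
  [set t : R | t != 0 -> `|t^-1 *: ((f \o shift x) t%:A - f x) - d| <= e] := HH FF.
have [r /= r0 H] := (@nbhs_ballP R R 0 _).1 H'; exists r => // h hr.
have [->|h0] := eqVneq h 0; first by rewrite add0r subrr mulr0 subrr normr0 mulr0.
have := H h; rewrite /ball /= sub0r normrN => /(_ hr h0).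
rewrite [_ *: 1]mulr1 [_ *: _]mulrC => H1.
have -> : f (h + x) - f x - d * h = ((f (h + x) - f x) / h - d) * h by field.
by rewrite normrM ler_wpM2r.
Qed.

Definition cexp z : C :=
  ((expR (complex.Re z))%:C * (cos (complex.Im z) +i* sin (complex.Im z)))%C.

Lemma cexpD z w : cexp (z + w) = cexp z * cexp w.
Proof.
case: z => a b; case: w => c d; rewrite /cexp /= expRD cosD sinD.
by apply/eqP; rewrite eq_complex /=; apply/andP; split; apply/eqP; ring.
Qed.

Lemma cexp0 : cexp 0 = 1.
Proof. by rewrite /cexp /= expR0 cos0 sin0 mul1r. Qed.

Lemma normc_cexp z : normc (cexp z) = expR (complex.Re z).
Proof.
rewrite /cexp normcM normc_real /= cos2Dsin2 sqrtr1 mulr1 ger0_norm //.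
exact: expR_ge0.
Qed.

Lemma cexp_neq0 z : cexp z != 0.
Proof. by rewrite -normc_gt0 normc_cexp expR_gt0. Qed.

Lemma cexpN z : cexp (- z) = (cexp z)^-1.
Proof.
by apply: (mulfI (cexp_neq0 z)); rewrite -cexpD subrr cexp0 divff ?cexp_neq0.
Qed.

Definition twopii : C := (0 +i* (pi *+ 2))%C.

Lemma cexp_period z : cexp (z + twopii) = cexp z.
Proof.
rewrite cexpD; have -> : cexp twopii = 1; last by rewrite mulr1.
by rewrite /cexp /= expR0 cos2pi sin2pi mul1r.
Qed.

(** Polar form: arccos determines the argument up to the sign of the imaginary
    part. *)
Lemma cexp_surj z : z != 0 -> exists w, cexp w = z.
Proof.
rewrite -normc_gt0; set r := normc z => r0.
have er := normc_sqr z; rewrite -/r in er.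
pose c := complex.Re z / r.
have c1 : -1 <= c <= 1.
  by rewrite -ler_norml normrM normfV (gtr0_norm r0) ler_pdivrMr // mul1r Re_le_normc.
pose t := acos c.
have st : sin t = `|complex.Im z| / r.
  rewrite sin_acos // /c.
  have -> : 1 - (complex.Re z / r) ^+ 2 = (`|complex.Im z| / r) ^+ 2.
    rewrite !expr_div_n real_normK ?num_real //.
    have -> : complex.Im z ^+ 2 = r ^+ 2 - complex.Re z ^+ 2 by rewrite er; ring.
    by field; lra.
  by rewrite sqrtr_sqr ger0_norm // divr_ge0 // ltW.
pose s := if complex.Im z < 0 then - t else t.
have cs : cos s = c by rewrite /s; case: ifP => _; rewrite ?cosN acosK // in_itv.
have ss : sin s = complex.Im z / r.
  rewrite /s; case: ltP => H; rewrite ?sinN st ?(ltr0_norm H) ?(ger0_norm H) //.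
  by rewrite mulNr opprK.
exists (ln r +i* s)%C; rewrite /cexp /= lnK ?posrE // cs ss /c.
case: (z) => a b /=; apply/eqP; rewrite eq_complex /=.
by apply/andP; split; apply/eqP; field; lra.
Qed.

(** With w = x + i y, the remainder e^w - 1 - w splits into the real remainder
    e^x - 1 - x, the trigonometric remainders times e^x, and the second order
    cross term (e^x - 1) y. *)
Lemma hasd_cexp0 : hasd cexp 0 1.
Proof.
move=> e e0.
have [k [k0 k1 ke]] : exists k : R, [/\ 0 < k, k <= 1 & k <= e / 10].
  exists (Num.min 1 (e / 10)); split; last 2 first.
  - by rewrite ge_min lexx.
  - by rewrite ge_min lexx orbT.
  - by rewrite lt_min ltr01 /=; lra.
have [r1 r10 H1] := is_derive_eps (is_derive_expR 0) k0.
have [r2 r20 H2] := is_derive_eps (is_derive_cos 0) k0.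
have [r3 r30 H3] := is_derive_eps (is_derive_sin 0) k0.
exists (Num.min (Num.min r1 r2) (Num.min r3 k)); first by rewrite !lt_min r10 r20 r30 k0.
move=> w; rewrite subr0 !lt_min => /andP[/andP[a1 a2] /andP[a3 a4]].
rewrite /= subr0 cexp0 mul1r.
have xw := Re_le_normc w; have yw := Im_le_normc w.
have {}H1 := H1 _ (le_lt_trans xw a1); have {}H2 := H2 _ (le_lt_trans yw a2).
have {}H3 := H3 _ (le_lt_trans yw a3).
move: H1 H2 H3; rewrite !addr0 expR0 cos0 sin0 oppr0 mul0r !subr0 !mul1r (addr0 (sin _)).
set x := complex.Re w in xw *; set y := complex.Im w in yw *; move=> H1 H2 H3.
have -> : cexp w - 1 - w = ((expR x - 1 - x)%:C + (expR x)%:C *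
   ((cos y - 1) +i* (sin y - y)) + (0 +i* ((expR x - 1) * y)))%C.
  rewrite /cexp -/x -/y; have -> : w = (x +i* y)%C by rewrite /x /y; case: (w).
  by apply/eqP; rewrite eq_complex /=; apply/andP; split; apply/eqP; ring.
have n0 := normc_ge0 w.
have xk : `|x| <= k by lra.
have ex1 : `|expR x - 1| <= 2 * k.
  have := ler_normD (expR x - 1 - x) x; rewrite subrK.
  by have := ler_wpM2r (normr_ge0 x) k1; lra.
have ex2 : expR x <= 3 by have := ler_norm (expR x - 1); lra.
have ex0 := expR_ge0 x.
apply: le_trans (ler_normcD _ _) _; rewrite normcZi normrM.
have A := ler_normcD (expR x - 1 - x)%:C%C ((expR x)%:C * ((cos y - 1) +i* (sin y - y)))%C.
apply: le_trans (lerD A (lexx _)) _.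
rewrite normc_real normcM normc_real (ger0_norm ex0).
have B : normc ((cos y - 1) +i* (sin y - y))%C <= 2 * k * normc w.
  apply: le_trans (normc_le_ReIm _) _ => /=.
  have := ler_wpM2l (ltW k0) yw; lra.
have n1 := normc_ge0 ((cos y - 1) +i* (sin y - y))%C.
have D : expR x * normc ((cos y - 1) +i* (sin y - y))%C <= 3 * (2 * k * normc w).
  exact: ler_pM.
have E : `|expR x - 1| * `|y| <= 2 * k * normc w by exact: ler_pM.
have G := ler_wpM2l (ltW k0) xw.
have := mulr_ge0 (ltW e0) n0; have := ler_wpM2r n0 ke; lra.
Qed.

(** The functional equation transports the derivative at 0. *)
Lemma hasd_cexp z : hasd cexp z (cexp z).
Proof.
have H : hasd (fun w => w - z) z (1 - 0) by apply: hasdB; [exact: hasd_id|exact: hasd_cst].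
have H0 : hasd cexp (z - z) 1 by rewrite subrr; exact: hasd_cexp0.
have := hasdZ (cexp z) (hasd_comp H H0).
rewrite subr0 !mulr1; apply: hasd_near_eq; apply: filterE => w /=.
by rewrite -cexpD addrC subrK.
Qed.

Lemma cdiff_cexp z : cdiff cexp z.
Proof. by exists (cexp z); exact: hasd_cexp. Qed.

End ComplexExponential.

(** * Goursat's lemma for dyadic trapezoid sums *)

Section Goursat.
Variable R : realType.
Local Notation C := R[i].
Implicit Types (f g : C -> C) (a b c z w d : C) (K : set C).

Definition mid a b : C := (a + b) / 2.

Lemma midC a b : mid a b = mid b a.
Proof. by rewrite /mid addrC. Qed.

(** The trapezoid sum of f over the segment from a to b cut into 2^n equal
    pieces.  The recursion by bisection, instead of an indexed sum, makes
    additivity under bisection hold by definition. *)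
Fixpoint tsum f (n : nat) a b : C :=
  if n is m.+1 then tsum f m a (mid a b) + tsum f m (mid a b) b
  else (f a + f b) / 2 * (b - a).

Lemma tsum_rev f n a b : tsum f n b a = - tsum f n a b.
Proof.
elim: n a b => [|n IH] a b /=; first by ring.
by rewrite (midC b a) (IH _ b) (IH a); ring.
Qed.

Lemma tsumD f g n a b : tsum (fun w => f w + g w) n a b = tsum f n a b + tsum g n a b.
Proof. by elim: n a b => [|n IH] a b /=; [ring|rewrite !IH; ring]. Qed.

Lemma tsumZ (k : C) f n a b : tsum (fun w => k * f w) n a b = k * tsum f n a b.
Proof. by elim: n a b => [|n IH] a b /=; [ring|rewrite !IH; ring]. Qed.

Lemma tsum_sum (I : Type) (r : seq I) (F : I -> C -> C) n a b :
  tsum (fun w => \sum_(i <- r) F i w) n a b = \sum_(i <- r) tsum (F i) n a b.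
Proof.
elim: n a b => [|n IH] a b /=; last by rewrite !IH -big_split.
by rewrite -big_split mulr_suml mulr_suml.
Qed.

Lemma tsum_affine (p q : C) n a b :
  tsum (fun w => p + q * w) n a b = (p + q * mid a b) * (b - a).
Proof.
elim: n a b => [|n IH] a b /=; first by rewrite /mid; field.
by rewrite !IH /mid; field.
Qed.

Lemma tsum_shift f (t : C) n a b :
  tsum f n (a + t) (b + t) = tsum (fun w => f (w + t)) n a b.
Proof.
elim: n a b => [|n IH] a b /=; first by ring.
have -> : mid (a + t) (b + t) = mid a b + t by rewrite /mid; field.
by rewrite !IH.
Qed.

(** Dyadic subdivision meets only midpoints, hence midpoint convexity is the
    convexity that matters here. *)
Definition midconvex K := forall a b, K a -> K b -> K (mid a b).

Lemma eq_tsum K f g n a b : midconvex K -> (forall w, K w -> f w = g w) ->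
  K a -> K b -> tsum f n a b = tsum g n a b.
Proof.
move=> Kc fg; elim: n a b => [|n IH] a b Ka Kb /=; first by rewrite !fg.
by have Km := Kc _ _ Ka Kb; rewrite !IH.
Qed.

Lemma eq_tsumT f g n a b : f =1 g -> tsum f n a b = tsum g n a b.
Proof. by move=> fg; apply: (@eq_tsum setT). Qed.

Lemma tsum_bound K f n a b (M : R) : midconvex K ->
  (forall w, K w -> normc (f w) <= M) -> K a -> K b ->
  normc (tsum f n a b) <= M * normc (b - a).
Proof.
move=> Kc fM; elim: n a b => [|n IH] a b Ka Kb /=.
  rewrite normcM ler_wpM2r ?normc_ge0 // normcM normcV normc_nat.
  have := ler_normcD (f a) (f b); have := fM _ Ka; have := fM _ Kb.
  by move=> ? ? ?; rewrite ler_pdivrMr //; lra.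
have Km := Kc _ _ Ka Kb; apply: le_trans (ler_normcD _ _) _.
have h1 : normc (mid a b - a) = normc (b - a) / 2.
  by rewrite -(@normc_nat R 2) -normcV -normcM; congr normc; rewrite /mid; field.
have h2 : normc (b - mid a b) = normc (b - a) / 2.
  by rewrite -(@normc_nat R 2) -normcV -normcM; congr normc; rewrite /mid; field.
by have := IH _ _ Ka Km; have := IH _ _ Km Kb; rewrite h1 h2; lra.
Qed.

Definition tri f n a b c := tsum f n a b + tsum f n b c + tsum f n c a.

(** The three inner sides are run through in both directions and cancel. *)
Lemma triS f n a b c : tri f n.+1 a b c =
  tri f n a (mid a b) (mid c a) + tri f n (mid a b) b (mid b c)
  + tri f n (mid c a) (mid b c) c + tri f n (mid a b) (mid b c) (mid c a).
Proof.
rewrite /tri /= (tsum_rev f n (mid a b) (mid b c)) (tsum_rev f n (mid a b) (mid c a)).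
by rewrite (tsum_rev f n (mid b c) (mid c a)); ring.
Qed.

Lemma tri_affine (p q : C) n a b c : tri (fun w => p + q * w) n a b c = 0.
Proof. by rewrite /tri !tsum_affine /mid; field. Qed.

Lemma triD f g n a b c : tri (fun w => f w + g w) n a b c = tri f n a b c + tri g n a b c.
Proof. by rewrite /tri !tsumD; ring. Qed.

Lemma tri_bound K f n a b c (M L : R) : midconvex K -> 0 <= M ->
  (forall w, K w -> normc (f w) <= M) -> K a -> K b -> K c ->
  normc (b - a) <= L -> normc (c - b) <= L -> normc (a - c) <= L ->
  normc (tri f n a b c) <= 3 * M * L.
Proof.
move=> Kc M0 fM Ka Kb Kcc h1 h2 h3; rewrite /tri.
apply: le_trans (ler_normcD _ _) _.
have := ler_normcD (tsum f n a b) (tsum f n b c).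
have := tsum_bound n Kc fM Ka Kb; have := tsum_bound n Kc fM Kb Kcc.
have := tsum_bound n Kc fM Kcc Ka.
have := ler_wpM2l M0 h1; have := ler_wpM2l M0 h2; have := ler_wpM2l M0 h3; lra.
Qed.

Lemma disk_midconvex z (r : R) : midconvex [set w | normc (w - z) <= r].
Proof.
move=> a b /= Ha Hb; have -> : mid a b - z = (a - z) / 2 + (b - z) / 2.
  by rewrite /mid; field.
apply: le_trans (ler_normcD _ _) _; rewrite !normcM !normcV !normc_nat; lra.
Qed.

(** Completeness with an explicit rate; the limit is the one along an
    ultrafilter, and the rate passes to it. *)
Lemma cauchy_limit (u : nat -> C) (r : nat -> R) :
  (forall k m, (k <= m)%N -> normc (u m - u k) <= r k) ->
  exists z, forall k, normc (z - u k) <= r k.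
Proof.
move=> H; have [U [UU sU]] := @ultraFilterLemma _ (\oo : set_system nat) _.
have [|z uz] := @ultra_clim R _ U u (r 0%N + normc (u 0%N)) UU.
  apply: sU; exists 0%N => // n _ /=.
  have := H 0%N n isT; have := ler_normcD (u n - u 0%N) (u 0%N).
  by rewrite subrK; lra.
exists z => k.
apply: (@clim_le _ _ U _ (fun n => u n - u k)).
  by apply: sU; exists k => // n /= kn; exact: H.
by apply: climB => //; exact: clim_cst.
Qed.

Definition cclosed K :=
  forall z, (forall e : R, 0 < e -> exists2 w, K w & normc (z - w) < e) -> K z.

(** The substitute for the vanishing of an integral: the approximating sums tend
    to 0. *)
Definition null (u : nat -> C) := clim (\oo : set_system nat) u 0.

Let small f (e : R) a b c :=
  (\oo : set_system nat) [set n | normc (tri f n a b c) <= e].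

(** The property of being eventually at most e is subdivided with e in
    proportion to the area, the mesh advancing by one level. *)
Let small_split f (e : R) a b c :
  small f (e / 4) a (mid a b) (mid c a) -> small f (e / 4) (mid a b) b (mid b c) ->
  small f (e / 4) (mid c a) (mid b c) c ->
  small f (e / 4) (mid a b) (mid b c) (mid c a) -> small f e a b c.
Proof.
move=> H1 H2 H3 H4; have [N _ H] := filterI (filterI H1 H2) (filterI H3 H4).
exists N.+1 => // -[//|n] /= Nn; rewrite triS.
have [[/= h1 h2] [/= h3 h4]] := H _ Nn.
apply: le_trans (ler_normcD _ _) _.
have := ler_normcD (tri f n a (mid a b) (mid c a) + tri f n (mid a b) b (mid b c))
  (tri f n (mid c a) (mid b c) c).
have := ler_normcD (tri f n a (mid a b) (mid c a)) (tri f n (mid a b) b (mid b c)).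
lra.
Qed.

Lemma half_pow_small (r : R) : 0 < r -> exists k, (2^-1 : R) ^+ k < r.
Proof.
move=> r0; have /cvgrPdist_lt : (fun k => (2^-1 : R) ^+ k) @ \oo --> (0 : R).
  by apply: cvg_expr; rewrite ger0_norm; lra.
move=> /(_ _ r0)[k _ /(_ k (leqnn k))] /=; rewrite sub0r normrN ger0_norm ?exprn_ge0 //; last lra.
by exists k.
Qed.

(** Goursat's argument.  If the sums over a triangle are not eventually at most
    e, then one of its four quarters fails with e / 4, and so on; the nested
    triangles shrink to a point z of K.  Near z the function is affine up to
    an error small compared with the diameter; the affine part contributes
    nothing, and the error contributes o(4^-k) to the k-th triangle, a
    contradiction. *)
Lemma goursat K f a b c : midconvex K -> cclosed K -> (forall w, K w -> cdiff f w) ->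
  K a -> K b -> K c -> null (fun n => tri f n a b c).
Proof.
move=> Kc Kcl fd Ka Kb Kcc.
suff main : forall e : R, 0 < e -> small f e a b c.
  move=> e e0; have e2 : 0 < e / 2 by lra.
  by apply: filterS (main _ e2) => n /=; rewrite subr0; lra.
move=> e e0; apply: contrapT => ns.
pose L := normc (b - a) + normc (c - b) + normc (a - c) + 1.
have [n1 n2 n3] : [/\ 0 <= normc (b - a), 0 <= normc (c - b) & 0 <= normc (a - c)].
  by split; exact: normc_ge0.
(* q and q4 measure the decay of the sides and of the tolerance. *)
pose q : R := 2^-1; pose q4 : R := 4^-1.
have q0 : 0 < q by rewrite /q; lra.
have q40 : 0 < q4 by rewrite /q4; lra.
have qk0 k : 0 < q ^+ k by apply: exprn_gt0.
have q4k k : q4 ^+ k = q ^+ k * q ^+ k.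
  by rewrite -exprMn; congr (_ ^+ _); rewrite /q /q4; lra.
pose P (k : nat) (t : C * C * C) :=
  [/\ [/\ K t.1.1, K t.1.2 & K t.2],
      [/\ normc (t.1.2 - t.1.1) <= L * q ^+ k, normc (t.2 - t.1.2) <= L * q ^+ k
        & normc (t.1.1 - t.2) <= L * q ^+ k] &
      ~ small f (e * q4 ^+ k) t.1.1 t.1.2 t.2].
have step (kt : nat * (C * C * C)) : exists t', P kt.1 kt.2 ->
    P kt.1.+1 t' /\ normc (t'.1.1 - kt.2.1.1) <= L * q ^+ kt.1.+1.
  case: kt => k [[x y] z] /=.
  have [[[/= Kx Ky Kz] [/= d1 d2 d3] /= nsm]|] := pselect (P k (x, y, z)); last first.
    by move=> nP; exists (x, y, z).
  have hn (u v : C) : normc v <= L * q ^+ k -> u = v / 2 \/ u = - (v / 2) ->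
      normc u <= L * q ^+ k.+1.
    move=> vL uv; have -> : normc u = normc v / 2.
      by case: uv => ->; rewrite ?normc_opp normcM normcV normc_nat.
    by rewrite exprS /q; lra.
  have [K1 K2 K3] : [/\ K (mid x y), K (mid y z) & K (mid z x)].
    by split; exact: Kc.
  have e4 : e * q4 ^+ k.+1 = e * q4 ^+ k / 4 by rewrite exprS /q4; lra.
  have z0 : normc (x - x) <= L * q ^+ k.+1.
    by rewrite subrr normc0 mulr_ge0 // ?ltW //; rewrite /L; lra.
  have [s1|s1] := pselect (small f (e * q4 ^+ k.+1) x (mid x y) (mid z x)); last first.
    exists (x, mid x y, mid z x); split=> //; split=> //; split=> /=.
    - by apply: hn d1 _; left; rewrite /mid; field.
    - by apply: hn d2 _; left; rewrite /mid; field.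
    - by apply: hn d3 _; left; rewrite /mid; field.
  have zm : normc (mid x y - x) <= L * q ^+ k.+1.
    by apply: hn d1 _; left; rewrite /mid; field.
  have zm3 : normc (mid z x - x) <= L * q ^+ k.+1.
    by apply: hn d3 _; right; rewrite /mid; field.
  have [s2|s2] := pselect (small f (e * q4 ^+ k.+1) (mid x y) y (mid y z)); last first.
    exists (mid x y, y, mid y z); split=> //; split=> //; split=> /=.
    - by apply: hn d1 _; left; rewrite /mid; field.
    - by apply: hn d2 _; left; rewrite /mid; field.
    - by apply: hn d3 _; left; rewrite /mid; field.
  have [s3|s3] := pselect (small f (e * q4 ^+ k.+1) (mid z x) (mid y z) z); last first.
    exists (mid z x, mid y z, z); split=> //; split=> //; split=> /=.
    - by apply: hn d1 _; left; rewrite /mid; field.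
    - by apply: hn d2 _; left; rewrite /mid; field.
    - by apply: hn d3 _; left; rewrite /mid; field.
  have [s4|s4] := pselect (small f (e * q4 ^+ k.+1) (mid x y) (mid y z) (mid z x)); last first.
    exists (mid x y, mid y z, mid z x); split=> //; split=> //; split=> /=.
    - by apply: hn d3 _; right; rewrite /mid; field.
    - by apply: hn d1 _; right; rewrite /mid; field.
    - by apply: hn d2 _; right; rewrite /mid; field.
  by exfalso; apply: nsm; rewrite e4 in s1 s2 s3 s4; exact: small_split.
have [F HF] := choice step.
pose t := fix t (k : nat) : C * C * C := if k is m.+1 then F (m, t m) else (a, b, c).
have Pt k : P k (t k).
  elim: k => [|k IH]; last by have [] := HF (k, t k) IH.
  by split => //; rewrite expr0 mulr1; [split; rewrite /L /=; lra|rewrite /=].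
have tS k : normc ((t k.+1).1.1 - (t k).1.1) <= L * q ^+ k.+1.
  by have [] := HF (k, t k) (Pt k).
have L0 : 0 < L by rewrite /L; lra.
have tkm k m : normc ((t (m + k)%N).1.1 - (t k).1.1) <= L * q ^+ k - L * q ^+ (m + k).
  elim: m => [|m IH]; first by rewrite add0n !subrr normc0.
  have := ler_normc_tri (t (m + k)%N).1.1 (t (m + k).+1).1.1 (t k).1.1.
  by have := tS (m + k)%N; rewrite addSn !exprS /q; lra.
have [z zt] : exists z, forall k, normc (z - (t k).1.1) <= L * q ^+ k.
  apply: cauchy_limit => k m km; rewrite -(subnK km); apply: le_trans (tkm _ _) _.
  by rewrite lerBlDr lerDl mulr_ge0 ?ltW.
have Kz : K z.
  apply: Kcl => s s0; have [|k Hk] := @half_pow_small (s / L); first exact: divr_gt0.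
  exists (t k).1.1; first by have [[]] := Pt k.
  by apply: le_lt_trans (zt k) _; rewrite mulrC -ltr_pdivlMr.
have [d Hd] := fd _ Kz.
(* The k-th triangle lies in the disk of radius 2 L q^k about z; the choice of
   eta makes three sides times the error there exactly e q4^k. *)
have eta0 : 0 < e / (6 * L ^+ 2) by rewrite divr_gt0 // mulr_gt0 // exprn_gt0.
have [r r0 Hr] := Hd _ eta0.
have [|k Hk] := @half_pow_small (r / (2 * L)); first by rewrite divr_gt0 // mulr_gt0.
have [[Kx Ky Kw] [d1 d2 d3]] := Pt k; apply.
rewrite ltr_pdivlMr in Hk; last by rewrite mulr_gt0.
have /= Hk' : 2 * (L * q ^+ k) < r by rewrite /q; lra.
have zk := zt k.
move: (t k).1.1 (t k).1.2 (t k).2 Kx Ky Kw d1 d2 d3 zk => x y w Kx Ky Kw d1 d2 d3 zk.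
exists 0%N => // n _ /=.
pose err u := f u - f z - d * (u - z).
have -> : tri f n x y w = tri err n x y w.
  have E : tri (fun u => (f z - d * z + d * u) + err u) n x y w = tri f n x y w.
    by rewrite /tri; do !congr (_ + _); apply: eq_tsumT => u; rewrite /err; ring.
  by rewrite -E triD tri_affine add0r.
have Lq : 0 < L * q ^+ k by rewrite mulr_gt0.
apply: le_trans (_ : 3 * (e / (6 * L ^+ 2) * (2 * (L * q ^+ k))) * (L * q ^+ k) <= _); last first.
  by rewrite q4k le_eqVlt; apply/orP; left; apply/eqP; field; lra.
apply: (tri_bound (K := [set u | normc (u - z) <= 2 * (L * q ^+ k)])) => //.
- exact: disk_midconvex.
- by rewrite mulr_ge0 // ?ltW // mulr_gt0.
- move=> u /= uz; apply: le_trans (Hr u _) _; first exact: le_lt_trans uz _.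
  by apply: ler_wpM2l => //; exact: ltW.
- by rewrite /= normcBC; lra.
- by have := ler_normc_tri x y z; rewrite /= (normcBC x z); lra.
- by have := ler_normc_tri x w z; rewrite /= (normcBC x z) (normcBC w x); lra.
Qed.

End Goursat.

(** * An exceptional vertex *)

Section CircleMeans.
Variable R : realType.
Local Notation C := R[i].
Implicit Types (f g : C -> C) (a b c z w d : C) (K : set C) (x : R).

Lemma nullD (u v : nat -> C) : null u -> null v -> null (fun n => u n + v n).
Proof. by move=> Hu Hv; have := climD Hu Hv; rewrite addr0; exact. Qed.

Lemma nullZ (k : C) (u : nat -> C) : null u -> null (fun n => k * u n).
Proof. by move=> Hu; have := climM (@clim_cst _ _ _ _ k) Hu; rewrite mulr0; exact. Qed.

Lemma eq_null (u v : nat -> C) : u =1 v -> null u -> null v.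
Proof. by move=> uv Hu; apply: (clim_near_eq _ Hu); apply: filterE => n /=. Qed.

Lemma Re_halfplane_midconvex (e c : C) (d : R) :
  midconvex [set w | d <= complex.Re (e * (w - c))].
Proof.
move=> a b /= Ha Hb.
have -> : e * (mid a b - c) = (e * (a - c)) / 2 + (e * (b - c)) / 2.
  by rewrite /mid; field.
rewrite raddfD /=.
have h (u : C) : complex.Re (u / 2) = complex.Re u / 2.
  have -> : (2 : C)^-1 = ((2^-1 : R)%:C)%C by rewrite fmorphV rmorph_nat.
  by case: u => p q /=; rewrite mulr0 subr0.
by rewrite !h; lra.
Qed.

Lemma Re_halfplane_closed (e c : C) (d : R) :
  cclosed [set w | d <= complex.Re (e * (w - c))].
Proof.
move=> z H /=; apply/ler_addgt0Pr => t t0.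
have k0 : 0 < normc e + 1 by have := normc_ge0 e; lra.
have [w /= Hw zw] := H _ (divr_gt0 t0 k0).
rewrite ltr_pdivlMr // in zw.
have -> : e * (z - c) = e * (w - c) + e * (z - w) by ring.
rewrite raddfD /=; have := Re_le_normc (e * (z - w)); rewrite normcM.
have := ler_norm (- complex.Re (e * (z - w))); rewrite normrN.
have := normc_ge0 (z - w); nra.
Qed.

Lemma setI_midconvex K K' : midconvex K -> midconvex K' -> midconvex (K `&` K').
Proof. by move=> H H' a b [? ?] [? ?]; split; [exact: H|exact: H']. Qed.

Lemma setI_cclosed K K' : cclosed K -> cclosed K' -> cclosed (K `&` K').
Proof.
by move=> H H' z Hz; split; [apply: H|apply: H'] => e /Hz[w [? ?] ?]; exists w.
Qed.

(** Boundedness near the vertex c suffices there.  Bisecting repeatedly, the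
    three quarters away from c lie in a half-plane that avoids c, where
    Goursat's lemma applies; what remains is a triangle at c whose perimeter
    halves at each step.  The linear form given by e, positive on both other
    vertices, provides these half-planes and excludes that c lies on the
    opposite side. *)
Lemma goursat_corner K f (M : R) (e : C) c a b : midconvex K -> cclosed K ->
  (forall w, K w -> w != c -> cdiff f w) ->
  (forall w, K w -> normc (f w) <= M) ->
  K c -> K a -> K b ->
  0 < complex.Re (e * (a - c)) -> 0 < complex.Re (e * (b - c)) ->
  null (fun n => tri f n c a b).
Proof.
move=> Kc Kcl fd fM Kcc Ka Kb ea eb.
have M0 : 0 <= M by apply: le_trans (fM _ Ka); exact: normc_ge0.
pose L := normc (a - c) + normc (b - a) + normc (c - b).
suff main k : forall a b (l : R), K a -> K b -> 0 < complex.Re (e * (a - c)) ->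
    0 < complex.Re (e * (b - c)) -> normc (a - c) <= l -> normc (b - a) <= l ->
    normc (c - b) <= l -> forall t : R, 0 < t ->
    (\oo : set_system nat)
      [set n | normc (tri f n c a b) <= 3 * M * l * (2^-1) ^+ k + t].
  move=> t t0; have L0 : 0 < 3 * M * L + 1.
    have : 0 <= 3 * M * L; last lra.
    by rewrite !mulr_ge0 // /L !addr_ge0 ?normc_ge0.
  have [|k Hk] := @half_pow_small R (t / 2 / (3 * M * L + 1)).
    by rewrite !divr_gt0.
  rewrite ltr_pdivlMr // in Hk; have t4 : 0 < t / 4 by lra.
  have [n1 n2 n3] : [/\ 0 <= normc (a - c), 0 <= normc (b - a) & 0 <= normc (c - b)].
    by split; exact: normc_ge0.
  have [] // := @main k a b L Ka Kb ea eb _ _ _ _ t4; rewrite ?/L; try lra.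
  move=> N _ HN; exists N => // n /= /HN /=; rewrite subr0 => Hn.
  apply: le_lt_trans Hn _.
  have := exprn_gt0 k (_ : 0 < 2^-1 :> R); rewrite invr_gt0 => /(_ (ltr0n _ 2)).
  rewrite -/L; lra.
clear L Ka Kb ea eb a b; elim: k => [|k IH] a b l Ka Kb ea eb h1 h2 h3 t t0.
  exists 0%N => // n _ /=; rewrite expr0 mulr1.
  have := tri_bound n Kc M0 fM Kcc Ka Kb h1 h2 h3; lra.
have t4 : 0 < t / 4 by lra.
have hR (u v : C) : complex.Re (e * (mid u v - c)) =
    (complex.Re (e * (u - c)) + complex.Re (e * (v - c))) / 2.
  have -> : e * (mid u v - c) = ((2^-1 : R)%:C)%C * (e * (u - c) + e * (v - c)).
    by rewrite fmorphV rmorph_nat /mid; field.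
  rewrite -raddfD /=; case: (e * (u - c) + e * (v - c)) => p q /=.
  by rewrite mul0r subr0 mulrC.
have hc : complex.Re (e * (c - c)) = 0 by rewrite subrr mulr0.
have [K1 K2 K3] : [/\ K (mid c a), K (mid a b) & K (mid b c)] by split; exact: Kc.
pose d := Num.min (complex.Re (e * (a - c))) (complex.Re (e * (b - c))) / 2.
have [d0 da db] : [/\ 0 < d, d <= complex.Re (e * (a - c)) / 2
    & d <= complex.Re (e * (b - c)) / 2].
  split; rewrite /d.
  - by rewrite divr_gt0 // lt_min ea.
  - by rewrite ler_pM2r ?invr_gt0 // ge_min lexx.
  - by rewrite ler_pM2r ?invr_gt0 // ge_min lexx orbT.
pose K' := K `&` [set w | d <= complex.Re (e * (w - c))].
have K'c : midconvex K' by apply: setI_midconvex => //; exact: Re_halfplane_midconvex.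
have K'cl : cclosed K' by apply: setI_cclosed => //; exact: Re_halfplane_closed.
have K'd w : K' w -> cdiff f w.
  move=> [Kw /= dw]; apply: fd => //; apply/eqP => wc; move: dw; rewrite wc hc; lra.
have [A1 A2 A3] : [/\ K' (mid c a), K' (mid a b) & K' (mid b c)].
  by split; split => //=; rewrite hR ?hc; lra.
have [A4 A5] : K' a /\ K' b by split; split => //=; lra.
have half (u v : C) : normc v <= l -> u = v / 2 \/ u = - (v / 2) -> normc u <= l / 2.
  move=> vL uv; have -> : normc u = normc v / 2.
    by case: uv => ->; rewrite ?normc_opp normcM normcV normc_nat.
  lra.
have E : (\oo : set_system nat) [set n | normc (tri f n c (mid c a) (mid b c))
    <= 3 * M * (l / 2) * (2^-1) ^+ k + t / 4].
  apply: IH => //; rewrite ?hR ?hc; try lra.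
  - by apply: half h1 _; left; rewrite /mid; field.
  - by apply: half h2 _; left; rewrite /mid; field.
  - by apply: half h3 _; left; rewrite /mid; field.
have N1 := goursat K'c K'cl K'd A1 A4 A2.
have N2 := goursat K'c K'cl K'd A3 A2 A5.
have N3 := goursat K'c K'cl K'd A1 A2 A3.
have [N _ HN] := filterI (filterI E (N1 _ t4)) (filterI (N2 _ t4) (N3 _ t4)).
exists N.+1 => // -[//|n] /= Nn; rewrite triS.
have [[/= i1 i2] [/= i3 i4]] := HN _ Nn; rewrite !subr0 in i2 i3 i4.
apply: le_trans (ler_normcD _ _) _.
have := ler_normcD (tri f n c (mid c a) (mid b c) + tri f n (mid c a) a (mid a b))
  (tri f n (mid b c) (mid a b) b).
have := ler_normcD (tri f n c (mid c a) (mid b c)) (tri f n (mid c a) a (mid a b)).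
rewrite exprS; lra.
Qed.

End CircleMeans.

(** * Means over circles and Cauchy's formula *)

Section CircleMeans2.
Variable R : realType.
Local Notation C := R[i].
Implicit Types (f g : C -> C) (a b c z w d : C) (K : set C) (x y al : R).

Definition pt x y : C := (x +i* y)%C.

Lemma twopii_neq0 : twopii R != 0.
Proof.
by rewrite -normc_gt0 normcZi normr_gt0 mulrn_eq0 /= gt_eqF ?pi_gt0.
Qed.

(** The circle of radius e^x enters through the vertical segment of length 2 pi
    above its logarithm, starting at the angle al; dividing by its length
    2 pi i turns the sum into a mean. *)
Definition vmean g n x al : C :=
  tsum (g \o @cexp R) n (pt x al) (pt x al + twopii R) / twopii R.

Definition halfplane (e c : C) : set C := [set w | 0 <= complex.Re (e * (w - c))].

Lemma halfplane_midconvex e c : midconvex (halfplane e c).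
Proof. exact: Re_halfplane_midconvex. Qed.

Lemma halfplane_cclosed e c : cclosed (halfplane e c).
Proof. exact: Re_halfplane_closed. Qed.

Definition Re_le x := halfplane (-1) (pt x 0).
Definition Re_ge x := halfplane 1 (pt x 0).
Definition Im_le y := halfplane 'i%C (pt 0 y).
Definition Im_ge y := halfplane (- 'i%C) (pt 0 y).

Lemma Re_leP x w : Re_le x w <-> complex.Re w <= x.
Proof.
by case: w => p q; rewrite /Re_le /halfplane /=; split => /= ; rewrite ?mulN1r /=; lra.
Qed.

Lemma Re_geP x w : Re_ge x w <-> x <= complex.Re w.
Proof. by case: w => p q; rewrite /Re_ge /halfplane /= ?mul1r /=; split; lra. Qed.

Lemma Im_leP y w : Im_le y w <-> complex.Im w <= y.
Proof. by case: w => p q; rewrite /Im_le /halfplane /=; split; lra. Qed.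

Lemma Im_geP y w : Im_ge y w <-> y <= complex.Im w.
Proof. by case: w => p q; rewrite /Im_ge /halfplane /=; split; lra. Qed.

Definition Re_eq x := Re_le x `&` Re_ge x.

Lemma Re_eqP x w : Re_eq x w <-> complex.Re w = x.
Proof.
split=> [[/Re_leP ? /Re_geP ?]|H]; first lra.
by split; [apply/Re_leP|apply/Re_geP]; rewrite H.
Qed.

Lemma Re_eq_midconvex x : midconvex (Re_eq x).
Proof. by apply: setI_midconvex; exact: halfplane_midconvex. Qed.

Lemma Re_eq_cclosed x : cclosed (Re_eq x).
Proof. by apply: setI_cclosed; exact: halfplane_cclosed. Qed.

Lemma Re_pt_twopii x y : complex.Re (pt x y + twopii R) = x.
Proof. by rewrite /= addr0. Qed.

Lemma Im_pt_twopii x y : complex.Im (pt x y + twopii R) = y + pi *+ 2.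
Proof. by []. Qed.

Lemma Re_eq_pt x y : Re_eq x (pt x y).
Proof. exact/Re_eqP. Qed.

Lemma Re_eq_pt2 x y : Re_eq x (pt x y + twopii R).
Proof. by apply/Re_eqP; rewrite Re_pt_twopii. Qed.

Lemma eq_vmean f g n x al : (forall w, normc w = expR x -> f w = g w) ->
  vmean f n x al = vmean g n x al.
Proof.
move=> fg; congr (_ / _).
apply: (eq_tsum _ (@Re_eq_midconvex x)); [|exact: Re_eq_pt|exact: Re_eq_pt2].
by move=> w /Re_eqP wx /=; apply: fg; rewrite normc_cexp wx.
Qed.

Lemma vmean_bound g n x al (M : R) :
  (forall w, normc w = expR x -> normc (g w) <= M) -> normc (vmean g n x al) <= M.
Proof.
move=> gM; rewrite normcM normcV ler_pdivrMr ?normc_gt0 ?twopii_neq0 //.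
have H := @tsum_bound _ (Re_eq x) (g \o @cexp R) n _ _ M (@Re_eq_midconvex x) _
  (@Re_eq_pt x al) (@Re_eq_pt2 x al).
have E : pt x al + twopii R - pt x al = twopii R by ring.
rewrite E in H; apply: H => w /Re_eqP wx /=; apply: gM; rewrite normc_cexp wx //.
Qed.

Lemma vmeanD f g n x al :
  vmean (fun w => f w + g w) n x al = vmean f n x al + vmean g n x al.
Proof. by rewrite /vmean -mulrDl -tsumD. Qed.

Lemma vmeanZ (k : C) f n x al : vmean (fun w => k * f w) n x al = k * vmean f n x al.
Proof. by rewrite /vmean mulrA -tsumZ. Qed.

Lemma vmeanB f g n x al :
  vmean (fun w => f w - g w) n x al = vmean f n x al - vmean g n x al.
Proof.
rewrite -mulN1r -vmeanZ -vmeanD; apply: eq_vmean => w _.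
by rewrite mulN1r.
Qed.

Lemma vmean_sum (I : Type) (r : seq I) (F : I -> C -> C) n x al :
  vmean (fun w => \sum_(i <- r) F i w) n x al = \sum_(i <- r) vmean (F i) n x al.
Proof. by rewrite /vmean -mulr_suml -tsum_sum. Qed.

Lemma vmean_cst (k : C) n x al : vmean (fun=> k) n x al = k.
Proof.
rewrite /vmean.
have -> : tsum ((fun=> k) \o @cexp R) n (pt x al) (pt x al + twopii R) =
    tsum (fun w => k + 0 * w) n (pt x al) (pt x al + twopii R).
  by apply: eq_tsumT => w /=; rewrite mul0r addr0.
rewrite tsum_affine mul0r addr0; have -> : pt x al + twopii R - pt x al = twopii R by ring.
by rewrite mulfK // twopii_neq0.
Qed.

(** Goursat's lemma for the two triangles of the parallelogram spanned by two
    vertical periods; the other two sides are translates of each other by the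
    period and cancel.  It changes the radius as well as the initial angle. *)
Lemma vmean_shift K g x al x' al' : midconvex K -> cclosed K ->
  (forall w, K w -> cdiff g (cexp w)) ->
  K (pt x al) -> K (pt x al + twopii R) -> K (pt x' al') -> K (pt x' al' + twopii R) ->
  null (fun n => vmean g n x al - vmean g n x' al').
Proof.
move=> Kc Kcl gd K1 K2 K3 K4.
have Gd w : K w -> cdiff (g \o @cexp R) w.
  by move=> Kw; apply: cdiff_comp; [exact: cdiff_cexp|exact: gd].
set p := pt x al in K1 K2 *; set p' := pt x' al' in K3 K4 *; set tau := twopii R.
have N1 := goursat Kc Kcl Gd K1 K3 K4.
have N2 := goursat Kc Kcl Gd K1 K4 K2.
apply: eq_null (nullZ (- tau^-1) (nullD N1 N2)) => n.
rewrite /vmean -/p -/p' -/tau /tri.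
set G := g \o _; have -> : tsum G n (p' + tau) (p + tau) = tsum G n p' p.
  by rewrite tsum_shift; apply: eq_tsumT => w; rewrite /G /= cexp_period.
rewrite (tsum_rev G n p p') (tsum_rev G n (p' + tau) p) (tsum_rev G n p (p + tau)).
by ring.
Qed.

(** It suffices to approximate u uniformly by null sequences. *)
Lemma null_close (u : nat -> C) :
  (forall e : R, 0 < e -> exists2 v : nat -> C, null v & forall n, normc (u n - v n) <= e) ->
  null u.
Proof.
move=> H e e0; have e2 : 0 < e / 2 by lra.
have [v vn uv] := H _ e2; apply: filterS (vn _ e2) => n /=; rewrite !subr0 => vs.
by have := ler_normcD (u n - v n) (v n); have := uv n; rewrite subrK; lra.
Qed.

(** The mean value property: move to a circle on which g is almost g 0. *)
Lemma vmean_center g x al : (forall w, w != 0 -> normc w <= expR x -> cdiff g w) ->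
  ccont g 0 -> null (fun n => vmean g n x al - g 0).
Proof.
move=> gd gc; apply: null_close => e e0.
have [r r0 Hr] := ccont_ex gc e0.
pose x' := Num.min x (ln (r / 2)).
have x'x : x' <= x by rewrite /x' ge_min lexx.
have x'r : expR x' < r.
  have : expR x' <= r / 2; last lra.
  by rewrite -[leRHS]lnK ?posrE ?divr_gt0 // ler_expR /x' ge_min lexx orbT.
exists (fun n => vmean g n x al - vmean g n x' al).
  apply: (@vmean_shift (Re_le x)) => //.
  - exact: halfplane_midconvex.
  - exact: halfplane_cclosed.
  - move=> w /Re_leP wx; apply: gd; first exact: cexp_neq0.
    by rewrite normc_cexp ler_expR.
  - exact/Re_leP.
  - by apply/Re_leP; rewrite Re_pt_twopii.
  - exact/Re_leP.
  - by apply/Re_leP; rewrite Re_pt_twopii.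
move=> n; have -> : vmean g n x al - g 0 - (vmean g n x al - vmean g n x' al) =
   vmean g n x' al - g 0 by ring.
rewrite -[X in _ - X](vmean_cst (g 0) n x' al) -vmeanB.
apply: vmean_bound => w wx; apply: ltW; apply: Hr.
by rewrite subr0 wx.
Qed.

(** Negative powers are holomorphic outside every circle, where they decay. *)
Lemma vmean_powV_null k x al : null (fun n => vmean (fun w => w^-1 ^+ k.+1) n x al).
Proof.
apply: null_close => e e0.
(* At abscissa X the powers are at most e, and they are at most e^-X. *)
pose X := Num.max 0 (- ln e).
have X0 : 0 <= X by rewrite /X le_max lexx.
have Xe : expR (- X) <= e.
  by rewrite -[leRHS]lnK ?posrE // ler_expR lerNl /X le_max lexx orbT.
have X1 : expR (- X) <= 1 by rewrite expR_le1; lra.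
exists (fun n => vmean (fun w => w^-1 ^+ k.+1) n x al - vmean (fun w => w^-1 ^+ k.+1) n X al).
  apply: (@vmean_shift setT) => // w _.
  apply: cdiffX; apply: cdiffV; [exact: cexp_neq0|exact: cdiff_id].
move=> n; rewrite opprB addrC subrK.
apply: vmean_bound => w wX; rewrite normcX normcV wX -expRN.
apply: le_trans Xe; rewrite exprS -[leRHS]mulr1 ler_wpM2l ?expR_ge0 //.
by apply: exprn_ile1 => //; exact: expR_ge0.
Qed.

Lemma cexp_inj z w : cexp z = cexp w -> `|complex.Im z - complex.Im w| <= pi -> z = w.
Proof.
move=> E H; have E1 : cexp (z - w) = 1 by rewrite cexpD cexpN -E divff ?cexp_neq0.
apply/eqP; rewrite -subr_eq0; apply/eqP; move: E1 H.
have -> : complex.Im z - complex.Im w = complex.Im (z - w) by case: (z); case: (w).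
case: (z - w) => p q /= E1 H.
have p0 : p = 0.
  have := normc_cexp (p +i* q)%C; rewrite E1 normc1 /= => /esym.
  by rewrite -expR0 => /expR_inj.
move: E1; rewrite /cexp /= p0 expR0 mul1r => -[c1 _].
have : `|q| = 0.
  apply: cos_inj; rewrite ?in_itv /= ?normr_ge0 ?lexx ?pi_ge0 //.
  by rewrite cos_norm c1 cos0.
by move/normr0_eq0 ->.
Qed.

(** Points where f is larger and larger would have a limit along an ultrafilter,
    and f is bounded near it. *)
Lemma disk_bounded f (r : R) : (forall w, normc w <= r -> ccont f w) ->
  exists M : R, forall w, normc w <= r -> normc (f w) <= M.
Proof.
move=> fc; apply: contrapT => nM.
have H (n : nat) : exists w, normc w <= r /\ n%:R < normc (f w).
  apply: contrapT => nw; apply: nM; exists n%:R => w wr.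
  by rewrite leNgt; apply/negP => nf; apply: nw; exists w.
have [u Hu] := choice H.
have [U [UU sU]] := @ultraFilterLemma _ (\oo : set_system nat) _.
have ub : U [set n | normc (u n) <= r] by apply: sU; exists 0%N => // n _; have [] := Hu n.
have [l ul] := ultra_clim UU ub.
have UP : ProperFilter U := @ultra_proper _ _ UU.
have lr := clim_le (FF := UP) ub ul.
have [d d0 Hd] := ccont_ex (fc _ lr) ltr01.
have [N HN] : exists N : nat, normc (f l) + 1 < N%:R.
  exists (Num.bound (normc (f l) + 1)).
  by apply: archi_boundP; rewrite addr_ge0 ?normc_ge0.
have V : U [set n | (N <= n)%N] by apply: sU; exists N.
have [n [/= Nn /Hd fn]] := filter_ex (filterI V (ul _ d0)).
have := lerB_normc (f (u n)) (f l); have [_] := Hu n.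
by rewrite -(ler_nat R) in Nn; lra.
Qed.

(** Cauchy's formula.  In logarithmic coordinates the difference quotient
    g is bounded near s, a logarithm of z, and holomorphic elsewhere.  The
    rectangle is placed so that s is interior to it, and is cut into four
    triangles with vertex s, one for each side, to which [goursat_corner]
    applies; hence the means of g over the two vertical sides agree in the
    limit.  The left side lies inside the circle through z, so its mean tends
    to g 0 = 0. *)
Lemma cauchy_null f x z : z != 0 -> normc z < expR x ->
  (forall w, normc w <= expR x -> cdiff f w) ->
  null (fun n => vmean (fun w => (f w - f z) * (w / (w - z))) n x 0).
Proof.
move=> z0 zx fd; pose g w := (f w - f z) * (w / (w - z)).
have [s sz] := cexp_surj z0.
have sx : complex.Re s < x by rewrite -ltr_expR -normc_cexp sz.
(* The rectangle [x', x] x [al, al + 2 pi] contains s in its interior, at the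
   middle height, so that s is the only logarithm of z in it. *)
pose x' := complex.Re s - 1; pose al := complex.Im s - pi.
have pi0 := @pi_gt0 R.
have gd w : normc w <= expR x -> w != z -> cdiff g w.
  move=> wx wz; apply: cdiffM.
    by apply: cdiffB; [exact: fd|exact: cdiff_cst].
  apply: cdiff_div; [by rewrite subr_eq0|exact: cdiff_id|].
  by apply: cdiffB; [exact: cdiff_id|exact: cdiff_cst].
have [Mg gM] : exists M, forall w, normc w <= expR x -> normc (g w) <= M.
  have [M fM] := disk_bounded (fun w wx => cdiff_cont (fd w wx)).
  have [d Hd] := fd z (ltW zx).
  have [r r0 Hr] := Hd _ ltr01.
  have ex := expR_gt0 x.
  have M0 : 0 <= M by apply: le_trans (fM _ (ltW zx)); exact: normc_ge0.
  have d0 := normc_ge0 d.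
  exists ((normc d + 1) * expR x + 2 * M / r * expR x) => w wx.
  have A0 : 0 <= (normc d + 1) * expR x by rewrite mulr_ge0 ?ltW //; lra.
  have B0 : 0 <= 2 * M / r * expR x.
    by rewrite mulr_ge0 ?(ltW ex) // divr_ge0 ?(ltW r0) // mulr_ge0.
  have [->|wz] := eqVneq w z; first by rewrite /g subrr mul0r normc0 addr_ge0.
  have p : 0 < normc (w - z) by rewrite normc_gt0 subr_eq0.
  have fM2 : normc (f w - f z) <= 2 * M.
    have := ler_normcB (f w) (f z); have := fM _ wx; have := fM _ (ltW zx); lra.
  rewrite /g !normcM normcV mulrCA mulrC.
  have [wr|wr] := ltP (normc (w - z)) r.
    have := Hr w wr; rewrite /= mul1r => H1.
    have H2 : normc (f w - f z) <= (normc d + 1) * normc (w - z).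
      have := ler_normcD (f w - f z - d * (w - z)) (d * (w - z)).
      by rewrite subrK normcM; lra.
    rewrite -ler_pdivrMr // in H2.
    have := ler_pM (divr_ge0 (normc_ge0 _) (ltW p)) (normc_ge0 w) H2 wx; lra.
  have H2 : normc (f w - f z) / normc (w - z) <= 2 * M / r.
    rewrite ler_pdivrMr //; apply: le_trans fM2 _.
    by rewrite mulrAC ler_pdivlMr // ler_wpM2l // mulr_ge0.
  have := ler_pM (divr_ge0 (normc_ge0 _) (ltW p)) (normc_ge0 w) H2 wx; lra.
pose K := (Re_le x `&` Re_ge x') `&` (Im_le (al + pi *+ 2) `&` Im_ge al).
have Kc : midconvex K.
  by apply: setI_midconvex; apply: setI_midconvex; exact: halfplane_midconvex.
have Kcl : cclosed K.
  by apply: setI_cclosed; apply: setI_cclosed; exact: halfplane_cclosed.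
have KP w : K w <-> (complex.Re w <= x /\ x' <= complex.Re w) /\
    (complex.Im w <= al + pi *+ 2 /\ al <= complex.Im w).
  by split=> [[[/Re_leP ? /Re_geP ?] [/Im_leP ? /Im_geP ?]]|
    [[/Re_leP ? /Re_geP ?] [/Im_leP ? /Im_geP ?]]].
have Kx w : K w -> normc (cexp w) <= expR x.
  by move=> /KP[[? _] _]; rewrite normc_cexp ler_expR.
have Gd w : K w -> w != s -> cdiff (g \o @cexp R) w.
  move=> Kw ws; apply: cdiff_comp; first exact: cdiff_cexp.
  apply: gd; first exact: Kx.
  apply: contra_neq ws; rewrite -sz => /cexp_inj; apply.
  move: Kw => /KP[_ [h1 h2]]; rewrite ler_norml; rewrite /al in h1 h2.
  by apply/andP; split; lra.
have GM w : K w -> normc ((g \o @cexp R) w) <= Mg by move=> /Kx; exact: gM.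
have Ks : K s by apply/KP; rewrite /x' /al; split; split; lra.
set A := pt x' al; set B := pt x al; set tau := twopii R.
have [KA KB KBt KAt] : [/\ K A, K B, K (B + tau) & K (A + tau)].
  by split; apply/KP; rewrite ?Re_pt_twopii ?Im_pt_twopii /= /x' /al; split; split; lra.
have N1 : null (fun n => tri (g \o @cexp R) n s A B).
  apply: (goursat_corner (e := 'i%C) Kc Kcl Gd GM) => //.
    by rewrite /A /pt /al; case: (s) => p q /=; lra.
  by rewrite /B /pt /al; case: (s) => p q /=; lra.
have N2 : null (fun n => tri (g \o @cexp R) n s B (B + tau)).
  apply: (goursat_corner (e := 1) Kc Kcl Gd GM) => //; rewrite mul1r.
    by rewrite /B /pt; case: (s) sx => p q /=; lra.
  by rewrite /B /pt; case: (s) sx => p q /=; lra.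
have N3 : null (fun n => tri (g \o @cexp R) n s (B + tau) (A + tau)).
  apply: (goursat_corner (e := - 'i%C) Kc Kcl Gd GM) => //.
    by rewrite /B /pt /al; case: (s) => p q /=; lra.
  by rewrite /A /pt /al; case: (s) => p q /=; lra.
have N4 : null (fun n => tri (g \o @cexp R) n s (A + tau) A).
  apply: (goursat_corner (e := -1) Kc Kcl Gd GM) => //; rewrite mulN1r.
    by rewrite /A /pt /x'; case: (s) sx => p q /=; lra.
  by rewrite /A /pt /x'; case: (s) sx => p q /=; lra.
have NN : null (fun n => vmean g n x al - vmean g n x' al).
  apply: eq_null (nullZ tau^-1 (nullD (nullD N1 N2) (nullD N3 N4))) => n.
  rewrite /vmean -/A -/B -/tau /tri.
  set G := g \o _; have -> : tsum G n (B + tau) (A + tau) = tsum G n B A.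
    by rewrite tsum_shift; apply: eq_tsumT => w; rewrite /G /= cexp_period.
  rewrite (tsum_rev G n A B) (tsum_rev G n A (A + tau)) (tsum_rev G n A s).
  by rewrite (tsum_rev G n B s) (tsum_rev G n (B + tau) s) (tsum_rev G n (A + tau) s); ring.
have ex' : expR x' < normc z by rewrite -sz normc_cexp ltr_expR /x'; lra.
have NC : null (fun n => vmean g n x' al - g 0).
  apply: vmean_center => [w w0 wx'|].
    apply: gd; first by apply: le_trans wx' _; rewrite ler_expR /x'; lra.
    by apply/eqP => wz; rewrite wz in wx'; lra.
  apply: cdiff_cont; apply: gd; first by rewrite normc0 expR_ge0.
  by rewrite eq_sym.
have g0 : g 0 = 0 by rewrite /g mul0r mulr0.
have NS : null (fun n => vmean g n x 0 - vmean g n x al).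
  apply: (vmean_shift (@Re_eq_midconvex x) (@Re_eq_cclosed x)).
  - move=> w /Re_eqP wx; apply: gd; first by rewrite normc_cexp wx.
    by apply/eqP => wz; move: zx; rewrite -wz normc_cexp wx ltxx.
  - exact: Re_eq_pt.
  - exact: Re_eq_pt2.
  - exact: Re_eq_pt.
  - exact: Re_eq_pt2.
apply: eq_null (nullD (nullD NS NN) NC) => n.
by rewrite g0 -/g; ring.
Qed.

End CircleMeans2.

(** * Taylor expansion *)

Section Taylor.
Variable R : realType.
Local Notation C := R[i].
Implicit Types (f g : C -> C) (a b : nat -> C) (z w d : C) (r x M : R).

Lemma circle_geometric (z w : C) m : normc z < normc w ->
  w / (w - z) = \sum_(k < m) z ^+ k * w^-1 ^+ k + (z / w) ^+ m * (w / (w - z)).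
Proof.
move=> zw; have w0 : w != 0 by rewrite -normc_gt0; have := normc_ge0 z; lra.
have wz : w - z != 0.
  by rewrite subr_eq0; apply/eqP => E; rewrite E ltxx in zw.
have wz' : z - w != 0 by rewrite -opprB oppr_eq0.
have u1 : z / w - 1 != 0.
  have -> : z / w - 1 = - (w - z) / w by field.
  by rewrite mulf_neq0 ?oppr_eq0 // invr_neq0.
have -> : \sum_(k < m) z ^+ k * w^-1 ^+ k = ((z / w) ^+ m - 1) / (z / w - 1).
  rewrite subrX1 mulrC mulKf //.
  by apply: eq_bigr => k _; rewrite exprMn.
have -> : w / (w - z) = - (z / w - 1)^-1.
  by field; rewrite mulN1r w0 wz wz'.
by move: ((z / w) ^+ m) => t; field; rewrite mulN1r w0 wz'.
Qed.

Lemma circle_kernel_le (z w : C) : normc z < normc w ->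
  normc (w / (w - z)) <= (1 - normc z / normc w)^-1.
Proof.
move=> zw; have z0 := normc_ge0 z; have w0 : 0 < normc w by lra.
have wz : normc w - normc z <= normc (w - z) by exact: lerB_normc.
have -> : (1 - normc z / normc w)^-1 = normc w / (normc w - normc z).
  by field; apply/andP; split; lra.
rewrite normcM normcV ler_wpM2l ?normc_ge0 // lef_pV2 ?posrE; lra.
Qed.

(** The geometric expansion of the Cauchy kernel under the mean, with the
    remainder bounded uniformly in the mesh n. *)
Lemma vmean_kernel (h : C -> C) n x al z m M : normc z < expR x ->
  (forall w, normc w = expR x -> normc (h w) <= M) ->
  normc (vmean (fun w => h w * (w / (w - z))) n x al -
    \sum_(k < m) z ^+ k * vmean (fun w => h w * w^-1 ^+ k) n x al)
  <= M * (normc z / expR x) ^+ m / (1 - normc z / expR x).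
Proof.
move=> zx hM; have z0 := normc_ge0 z; have ex := expR_gt0 x.
have -> : \sum_(k < m) z ^+ k * vmean (fun w => h w * w^-1 ^+ k) n x al =
    vmean (fun w => \sum_(k < m) z ^+ k * (h w * w^-1 ^+ k)) n x al.
  by rewrite vmean_sum; apply: eq_bigr => k _; rewrite vmeanZ.
rewrite -vmeanB.
have -> : vmean (fun w => h w * (w / (w - z)) - \sum_(k < m) z ^+ k * (h w * w^-1 ^+ k))
    n x al = vmean (fun w => h w * ((z / w) ^+ m * (w / (w - z)))) n x al.
  apply: eq_vmean => w wx; rewrite {1}(@circle_geometric _ _ m) ?wx //.
  have -> : \sum_(k < m) z ^+ k * (h w * w^-1 ^+ k) =
      h w * \sum_(k < m) z ^+ k * w^-1 ^+ k.
    by rewrite mulr_sumr; apply: eq_bigr => k _; ring.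
  by ring.
apply: vmean_bound => w wx; rewrite normcM normcM normcX normcM normcV wx.
have K := @circle_kernel_le z w; rewrite wx in K.
have q0 : 0 <= normc z / expR x by rewrite divr_ge0 // ltW.
rewrite -mulrA; apply: ler_pM; rewrite ?normc_ge0 ?mulr_ge0 ?exprn_ge0 ?normc_ge0 //.
  exact: hM.
by apply: ler_wpM2l; [exact: exprn_ge0|exact: K].
Qed.

Definition holo f := forall z, normc z < 1 -> cdiff f z.

Definition psum a m z := \sum_(k < m) a k * z ^+ k.

Lemma null_sub (u : nat -> C) (U : set_system nat) :
  \oo `<=` U -> null u -> clim U u 0.
Proof. by move=> sU un e /un; exact: sU. Qed.

(** To show that something is at most 0 it suffices to bound it by a geometric
    sequence. *)
Lemma le_geom (c : R) (q M : R) : 0 <= q < 1 ->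
  (forall m, c <= M * q ^+ m) -> c <= 0.
Proof.
move=> /andP[q0 q1] H; apply/ler_addgt0Pr => e e0; rewrite add0r.
have [|q00] := eqVneq q 0.
  by move=> E; have := H 1%N; rewrite E expr1 mulr0; lra.
have [M0|M0] := lerP M 0; first by have := H 0%N; rewrite expr0; lra.
have /cvgrPdist_lt : (fun k => q ^+ k) @ \oo --> (0 : R).
  by apply: cvg_expr; rewrite ger0_norm.
move=> /(_ (e / M))[|k _ /(_ k (leqnn k))] /=; first exact: divr_gt0.
rewrite sub0r normrN ger0_norm ?exprn_ge0 // ltr_pdivlMr // => Hk.
by have := H k; lra.
Qed.

(** The coefficients are limits along an ultrafilter U of the means of f w / w^k,
    which exist as the means are bounded; a mean is linear and at most the
    supremum in modulus, so its limit works as an integral over the circle.  By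
    [vmean_shift] they do not depend on the radius.  The limit of [vmean_kernel]
    and Cauchy's formula give the expansion, the mean of w / (w - z) tending
    to 1. *)
Theorem taylor f : holo f -> exists a, a 0%N = f 0 /\
  forall r M, 0 < r < 1 -> (forall w, normc w = r -> normc (f w) <= M) ->
    (forall k, normc (a k) * r ^+ k <= M) /\
    (forall z m, normc z < r ->
      normc (f z - psum a m z) <= M * (normc z / r) ^+ m / (1 - normc z / r)).
Proof.
move=> fh.
have [U [UU sU]] := @ultraFilterLemma _ (\oo : set_system nat) _.
have UP : ProperFilter U := @ultra_proper _ _ UU.
have UF : Filter U := @filter_filter _ _ UP.
have exr r : 0 < r -> expR (ln r) = r by move=> r0; rewrite lnK.
have cV k w : w != 0 -> normc w < 1 -> cdiff (fun w => f w * w^-1 ^+ k) w.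
  move=> w0 w1; apply: cdiffM; first exact: fh.
  by apply: cdiffX; apply: cdiffV => //; exact: cdiff_id.
have bnd k r M n : 0 < r -> (forall w, normc w = r -> normc (f w) <= M) ->
    normc (vmean (fun w => f w * w^-1 ^+ k) n (ln r) 0) <= M / r ^+ k.
  move=> r0 fM; apply: vmean_bound => w; rewrite exr // => wr.
  by rewrite normcM normcX normcV wr exprVn ler_pM2r ?invr_gt0 ?exprn_gt0 // fM.
have h0 : 0 < (2^-1 : R) by lra.
have [M0 HM0] : exists M0, forall w, normc w <= 2^-1 -> normc (f w) <= M0.
  by apply: disk_bounded => w wr; apply/cdiff_cont/fh; lra.
have HA (k : nat) : exists ak,
    clim U (fun n => vmean (fun w => f w * w^-1 ^+ k) n (ln (2^-1)) 0) ak.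
  apply: (@ultra_clim _ _ _ _ (M0 / (2^-1) ^+ k)).
  apply: filterE => n /=; apply: bnd => // w wr; apply: HM0; lra.
have [a Ha] := choice HA.
have Har k r : 0 < r < 1 ->
    clim U (fun n => vmean (fun w => f w * w^-1 ^+ k) n (ln r) 0) (a k).
  move=> /andP[r0 r1]; pose X := Num.max (ln r) (ln 2^-1).
  have X1 : expR X < 1.
    by rewrite /X; case: (leP (ln r) (ln 2^-1)) => _; rewrite exr //; lra.
  have N : null (fun n => vmean (fun w => f w * w^-1 ^+ k) n (ln r) 0 -
      vmean (fun w => f w * w^-1 ^+ k) n (ln 2^-1) 0).
    apply: (@vmean_shift _ (Re_le X)).
    - exact: halfplane_midconvex.
    - exact: halfplane_cclosed.
    - move=> w /Re_leP wX; apply: cV; first exact: cexp_neq0.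
      by rewrite normc_cexp; apply: le_lt_trans X1; rewrite ler_expR.
    - by apply/Re_leP; rewrite /= /X le_max lexx.
    - by apply/Re_leP; rewrite Re_pt_twopii /X le_max lexx.
    - by apply/Re_leP; rewrite /= /X le_max lexx orbT.
    - by apply/Re_leP; rewrite Re_pt_twopii /X le_max lexx orbT.
  have := climD (FF := UF) (null_sub sU N) (Ha k); rewrite add0r => L; apply: (clim_near_eq (FF := UF) _ L).
  by apply: filterE => n /=; rewrite subrK.
exists a; split.
  have N : null (fun n => vmean f n (ln 2^-1) 0 - f 0).
    apply: vmean_center => [w _|]; last by apply/cdiff_cont/fh; rewrite normc0.
    by rewrite exr // => wr; apply: fh; lra.
  have := climD (FF := UF) (null_sub sU N) (@clim_cst _ _ U UF (f 0)); rewrite add0r => L.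
  apply: (clim_unique (FF := UP) _ L); apply: (clim_near_eq (FF := UF) _ (Ha 0%N)); apply: filterE => n /=.
  rewrite subrK; apply: eq_vmean => w _; by rewrite expr0 mulr1.
move=> r M r01 fM; have /andP[r0 r1] := r01; split=> [k|z m zr].
  rewrite -ler_pdivlMr ?exprn_gt0 //.
  apply: (clim_le (FF := UP) _ (Har k r r01)); apply: filterE => n /=; exact: bnd.
have z0 := normc_ge0 z.
pose q := normc z / r.
have q01 : 0 <= q < 1 by rewrite /q divr_ge0 ?(ltW r0) //= ltr_pdivrMr // mul1r.
have Mq0 : 0 <= M.
  by apply: le_trans (fM ((r%:C)%C) _); rewrite ?normc_ge0 // normc_real ger0_norm // ltW.
have bk (h : C -> C) M' n : (forall w, normc w = r -> normc (h w) <= M') ->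
    normc (vmean (fun w => h w * (w / (w - z))) n (ln r) 0) <= M' / (1 - q).
  move=> hM; have := @vmean_kernel h n (ln r) 0 z 0 M'; rewrite exr // => /(_ zr hM).
  by rewrite big_ord0 subr0 expr0 mulr1.
have [e He] : exists e, clim U (fun n => vmean (fun w => f w * (w / (w - z))) n (ln r) 0) e.
  by apply: (@ultra_clim _ _ _ _ (M / (1 - q))); apply: filterE => n /=; exact: bk.
have [c Hc] : exists c, clim U (fun n => vmean (fun w => 1 * (w / (w - z))) n (ln r) 0) c.
  apply: (@ultra_clim _ _ _ _ (1 / (1 - q))); apply: filterE => n /=.
  by apply: (bk (fun=> 1)) => w _; rewrite normc1.
(* The mean of w / (w - z): all terms of its expansion but the first vanish. *)
have c1 : c = 1.
  apply/eqP; rewrite -subr_eq0 -normc_eq0 eq_le normc_ge0 andbT.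
  apply: (@le_geom _ q ((1 - q)^-1)) => // j.
  have K : clim U (fun n => vmean (fun w => 1 * (w / (w - z))) n (ln r) 0 -
      \sum_(k < j.+1) z ^+ k * vmean (fun w => 1 * w^-1 ^+ k) n (ln r) 0)
      (c - \sum_(k < j.+1) z ^+ k * (k == 0 :> nat)%:R).
    apply: climB => //; apply: clim_sum => -[k kj] _ /=; apply: climM.
      exact: clim_cst.
    case: k kj => [|k] kj /=.
      apply: (clim_near_eq (FF := UF) _ (@clim_cst _ _ U UF 1)); apply: filterE => n /=.
      rewrite -[LHS](vmean_cst 1 n (ln r) 0); apply: eq_vmean => w _.
      by rewrite mul1r expr0.
    apply: (clim_near_eq (FF := UF) _ (null_sub sU (@vmean_powV_null _ k (ln r) 0))).
    by apply: filterE => n /=; apply: eq_vmean => w _; rewrite mul1r.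
  rewrite big_ord_recl /= expr0 mulr1 big1 ?addr0 in K; last first.
    by move=> i _; rewrite mulr0.
  apply: (clim_le (FF := UP) _ K); apply: filterE => n /=.
  have := @vmean_kernel (fun=> 1) n (ln r) 0 z j.+1 1; rewrite exr // => /(_ zr).
  rewrite -/q => H; apply: le_trans (H _) _; first by move=> w _; rewrite normc1.
  rewrite mul1r mulrC; have /andP[q0 q1] := q01.
  rewrite ler_pM2l ?invr_gt0 ?subr_gt0 // exprS.
  by apply: ler_piMl; [exact: exprn_ge0|exact: ltW].
have ez : e = f z.
  have [z00|zn0] := eqVneq z 0.
    have N : null (fun n => vmean f n (ln r) 0 - f 0).
      apply: vmean_center => [w _|]; last by apply/cdiff_cont/fh; rewrite normc0.
      by rewrite exr // => wr; apply: fh; lra.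
    have := climD (FF := UF) (null_sub sU N) (@clim_cst _ _ U UF (f 0)); rewrite add0r z00 => L.
    apply: (clim_unique (FF := UP) _ L); apply: (clim_near_eq (FF := UF) _ He); apply: filterE => n /=.
    rewrite subrK; apply: eq_vmean => w; rewrite exr // z00 subr0 => wr.
    by rewrite divff ?mulr1 // -normc_gt0 wr.
  have N := @cauchy_null _ f (ln r) z zn0; rewrite exr // in N.
  have {}N := N zr (fun w wr => fh w (le_lt_trans wr r1)).
  have := climB (FF := UF) He (climM (FF := UF) (@clim_cst _ _ U UF (f z)) Hc); rewrite c1 mulr1 => L.
  apply/eqP; rewrite -subr_eq0; apply/eqP; apply: (clim_unique (FF := UP) L).
  apply: (clim_near_eq (FF := UF) _ (null_sub sU N)); apply: filterE => n /=.
  rewrite -vmeanZ -vmeanB; apply: eq_vmean => w _; ring.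
have K : clim U (fun n => vmean (fun w => f w * (w / (w - z))) n (ln r) 0 -
      \sum_(k < m) z ^+ k * vmean (fun w => f w * w^-1 ^+ k) n (ln r) 0)
      (f z - psum a m z).
  rewrite -ez; apply: climB => //; apply: clim_sum => k _.
  by rewrite mulrC; apply: climM; [exact: clim_cst|exact: Har].
apply: (clim_le (FF := UP) _ K); apply: filterE => n /=.
by have := @vmean_kernel f n (ln r) 0 z m M; rewrite exr //; exact.
Qed.

End Taylor.

(** * Power series, the maximum principle and logarithms *)

Section PowerSeries.
Variable R : realType.
Local Notation C := R[i].
Implicit Types (f g : C -> C) (a b : nat -> C) (z w d : C) (r x M : R).

(** The radius of convergence is at least 1, in the form of Cauchy's
    estimates. *)
Definition tame a := forall r, 0 < r < 1 -> exists M, forall k, normc (a k) * r ^+ k <= M.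

Definition sums a f := forall z, normc z < 1 ->
  clim (\oo : set_system nat) (fun m => psum a m z) (f z).

Lemma clim_shiftS (u : nat -> C) l :
  clim (\oo : set_system nat) u l -> clim (\oo : set_system nat) (fun n => u n.+1) l.
Proof.
move=> ul e /ul[N _ H]; exists N => // n /= Nn; apply: H => /=; exact: leqW.
Qed.

Lemma psum_tail a r M z m k : 0 < r -> (forall k, normc (a k) * r ^+ k <= M) ->
  normc z < r ->
  normc (psum a (m + k)%N z - psum a m z) <=
    M * (normc z / r) ^+ m / (1 - normc z / r).
Proof.
move=> r0 aM zr; set q := normc z / r.
have q0 : 0 <= q by rewrite divr_ge0 ?normc_ge0 // ltW.
have q1 : 0 < 1 - q by rewrite subr_gt0 ltr_pdivrMr // mul1r.
have M0 : 0 <= M by apply: le_trans (aM 0%N); rewrite expr0 mulr1 normc_ge0.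
apply: le_trans (_ : M * (q ^+ m - q ^+ (m + k)) / (1 - q) <= _); last first.
  rewrite ler_pM2r ?invr_gt0 // ler_wpM2l // gerBl exprn_ge0 //.
elim: k => [|k IH]; first by rewrite addn0 !subrr normc0 mulr0 mul0r.
rewrite addnS /psum big_ord_recr /= -/(psum a _ z) -/(psum a _ z).
have -> : psum a (m + k) z + a (m + k)%N * z ^+ (m + k) - psum a m z =
  (psum a (m + k) z - psum a m z) + a (m + k)%N * z ^+ (m + k) by ring.
apply: le_trans (ler_normcD _ _) _.
have H : normc (a (m + k)%N * z ^+ (m + k)) <= M * q ^+ (m + k).
  rewrite normcM normcX.
  have -> : normc z ^+ (m + k) = r ^+ (m + k) * q ^+ (m + k).
    by rewrite -exprMn /q mulrC divfK // gt_eqF.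
  by rewrite mulrA ler_wpM2r // exprn_ge0.
apply: le_trans (lerD IH H) _.
have -> : M * q ^+ (m + k) = M * (q ^+ (m + k) - q ^+ (m + k).+1) / (1 - q).
  by rewrite exprS; field; lra.
by rewrite -mulrDl -mulrDr le_eqVlt; apply/orP; left; apply/eqP; congr (_ * _ / _); ring.
Qed.

Lemma sums_tail a f r M z m : 0 < r <= 1 -> sums a f ->
  (forall k, normc (a k) * r ^+ k <= M) -> normc z < r ->
  normc (f z - psum a m z) <= M * (normc z / r) ^+ m / (1 - normc z / r).
Proof.
move=> /andP[r0 r1] af aM zr.
pose proof (climB (af z (lt_le_trans zr r1))
  (@clim_cst _ _ (\oo : set_system nat) _ (psum a m z))) as L.
apply: (clim_le _ L); exists m => // n /= mn.
by rewrite -(subnKC mn); exact: psum_tail.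
Qed.

Lemma radius_between z : normc z < 1 -> exists r, 0 < r < 1 /\ normc z < r.
Proof.
move=> z1; have z0 := normc_ge0 z; exists ((1 + normc z) / 2).
by split; [apply/andP; split|]; lra.
Qed.

Lemma sums_exist a : tame a -> exists f, sums a f.
Proof.
move=> at_; have H z : exists l, normc z < 1 ->
    clim (\oo : set_system nat) (fun m => psum a m z) l.
  have [z1|z1] := ltP (normc z) 1; last by exists 0.
  have [r [/andP[r0 r1] zr]] := radius_between z1.
  have [M aM] := at_ r (introT andP (conj r0 r1)).
  set q := normc z / r.
  have q0 : 0 <= q by rewrite divr_ge0 ?normc_ge0 // ltW.
  have q1 : q < 1 by rewrite ltr_pdivrMr // mul1r.
  have [|l Hl] := @cauchy_limit _ (fun m => psum a m z)
    (fun m => M * q ^+ m / (1 - q)).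
    by move=> k m km; rewrite -(subnKC km); exact: psum_tail.
  exists l => _ e e0.
  have /cvgrPdist_lt : (fun k => q ^+ k) @ \oo --> (0 : R).
    by apply: cvg_expr; rewrite ger0_norm.
  have M0 : 0 <= M by apply: le_trans (aM 0%N); rewrite expr0 mulr1 normc_ge0.
  have M1 : 0 < M + 1 by lra.
  have q1' : 0 < 1 - q by lra.
  move=> /(_ (e * (1 - q) / (M + 1)))[|N _ HN].
    by rewrite !divr_gt0 ?mulr_gt0.
  exists N => // n /= /HN /=; rewrite sub0r normrN ger0_norm ?exprn_ge0 //.
  rewrite ltr_pdivlMr // => Hn; rewrite normcBC; apply: le_lt_trans (Hl n) _.
  by rewrite ltr_pdivrMr //; have := exprn_ge0 n q0; lra.
have [f Hf] := choice H; by exists f => z; exact: Hf.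
Qed.

Lemma sums0 a f : sums a f -> f 0 = a 0%N.
Proof.
move=> af; have n0 : normc (0 : C) < 1 by rewrite normc0.
have L := clim_shiftS (af 0 n0).
apply: (clim_unique L).
apply: clim_near_eq (@clim_cst _ _ (\oo : set_system nat) _ (a 0%N)).
apply: filterE => n /=; rewrite /psum big_ord_recl /= expr0 mulr1 big1 ?addr0 //.
by move=> i _; rewrite expr0n /= mulr0.
Qed.

Lemma taylor_sums f : holo f -> exists a, [/\ tame a, sums a f &
  forall r M, 0 < r < 1 -> (forall w, normc w = r -> normc (f w) <= M) ->
    forall k, normc (a k) * r ^+ k <= M].
Proof.
move=> fh; have [a [a0 Ha]] := taylor fh; exists a.
have B r : 0 < r < 1 -> exists M, forall w, normc w = r -> normc (f w) <= M.
  move=> /andP[r0 r1]; have [M HM] : exists M, forall w, normc w <= r -> normc (f w) <= M.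
    by apply: disk_bounded => w wr; apply/cdiff_cont/fh; lra.
  by exists M => w wr; apply: HM; rewrite wr.
split.
- by move=> r r01; have [M fM] := B r r01; exists M; have [] := Ha r M r01 fM.
- move=> z z1; have [r [r01 zr]] := radius_between z1; have [M fM] := B r r01.
  have [_ H] := Ha r M r01 fM; move: r01 => /andP[r0 r1] e e0.
  set q := normc z / r in H *.
  have q0 : 0 <= q by rewrite divr_ge0 ?normc_ge0 // ltW.
  have q1 : q < 1 by rewrite ltr_pdivrMr // mul1r.
  have M0 : 0 <= M.
    by apply: le_trans (fM ((r%:C)%C) _); rewrite ?normc_ge0 // normc_real ger0_norm // ltW.
  have /cvgrPdist_lt : (fun k => q ^+ k) @ \oo --> (0 : R).
    by apply: cvg_expr; rewrite ger0_norm.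
  have M1 : 0 < M + 1 by lra.
  have q1' : 0 < 1 - q by lra.
  move=> /(_ (e * (1 - q) / (M + 1)))[|N _ HN].
    by rewrite !divr_gt0 ?mulr_gt0.
  exists N => // n /= /HN /=; rewrite sub0r normrN ger0_norm ?exprn_ge0 //.
  rewrite ltr_pdivlMr // => Hn; rewrite normcBC; apply: le_lt_trans (H _ n zr) _.
  by rewrite -/q ltr_pdivrMr //; have := exprn_ge0 n q0; lra.
- by move=> r M r01 fM; have [] := Ha r M r01 fM.
Qed.

Definition dcoef a (k : nat) : C := k.+1%:R * a k.+1.

Lemma bernoulli_pow (x h : R) k : 0 <= x -> 0 <= h ->
  k.+1%:R * h * x ^+ k + x ^+ k.+1 <= (x + h) ^+ k.+1.
Proof.
move=> x0 h0; elim: k => [|k IH]; first by rewrite expr0 !expr1; lra.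
have xh : 0 <= x + h by lra.
rewrite (exprS (x + h)); apply: le_trans (ler_wpM2l xh IH).
have A : 0 <= h * (k.+1%:R * h * x ^+ k) by rewrite !mulr_ge0 ?exprn_ge0.
have -> : (k.+2%:R : R) = k.+1%:R + 1 by rewrite -natr1.
by rewrite !(exprS x) in A *; lra.
Qed.

Lemma tame_dcoef a : tame a -> tame (dcoef a).
Proof.
move=> at_ r /andP[r0 r1]; pose s := (1 + r) / 2.
have s01 : 0 < s < 1 by rewrite /s; apply/andP; split; lra.
have [M aM] := at_ s s01; exists (M / (s - r)) => k.
have sr : 0 < s - r by rewrite /s; lra.
rewrite ler_pdivlMr // /dcoef normcM normc_nat.
apply: le_trans (aM k.+1).
have -> : k.+1%:R * normc (a k.+1) * r ^+ k * (s - r) =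
  normc (a k.+1) * (k.+1%:R * (s - r) * r ^+ k) by ring.
rewrite ler_wpM2l ?normc_ge0 //.
have := @bernoulli_pow r (s - r) k (ltW r0) (ltW sr).
rewrite (_ : r + (s - r) = s); last by ring.
by have := exprn_ge0 k.+1 (ltW r0); lra.
Qed.

(** The second order remainder of the k-th power has positive coefficients, so
    it is dominated by its value at x and e, scaled by the square of |h| / e.
    Summed over k this majorant gives a convergent geometric series, with no
    factor k^2. *)
Lemma taylor_rem (z h : C) (x e : R) k : normc z <= x -> 0 < e -> normc h <= e ->
  normc ((z + h) ^+ k - z ^+ k - k%:R * h * z ^+ k.-1) <=
  (normc h / e) ^+ 2 * ((x + e) ^+ k - x ^+ k - k%:R * e * x ^+ k.-1).
Proof.
move=> zx e0 he; have z0 := normc_ge0 z; have h0 := normc_ge0 h.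
have x0 : 0 <= x by lra.
elim: k => [|k IH].
  by rewrite !expr0 mul0r !subrr mul0r subr0 mul0r mul0r subr0 mulr0 normc0.
have E (S : comNzRingType) (u v : S) : (u + v) ^+ k.+1 - u ^+ k.+1 - k.+1%:R * v * u ^+ k.+1.-1 =
    (u + v) * ((u + v) ^+ k - u ^+ k - k%:R * v * u ^+ k.-1) + k%:R * v ^+ 2 * u ^+ k.-1.
  case: k {IH} => [|k] /=; first by rewrite !expr0 !expr1; ring.
  by rewrite !exprS -[k.+2%:R in LHS]natr1; ring.
rewrite !E; apply: le_trans (ler_normcD _ _) _; rewrite [leRHS]mulrDr; apply: lerD.
  rewrite normcM mulrCA; apply: ler_pM; rewrite ?normc_ge0 //.
  by have := ler_normcD z h; lra.
rewrite normcM (normcM k%:R) normc_nat !normcX.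
have -> : (normc h / e) ^+ 2 * (k%:R * e ^+ 2 * x ^+ k.-1) =
    k%:R * normc h ^+ 2 * x ^+ k.-1 by field; lra.
apply: ler_wpM2l; first by rewrite mulr_ge0 ?exprn_ge0.
by apply: lerXn2r; rewrite ?nnegrE.
Qed.

(** Termwise differentiation.  The remainders of the partial sums are bounded by
    a constant times |w - z|^2 independent of their number ([taylor_rem]),
    and the bound passes to the limit. *)
Lemma sums_deriv a f g z : tame a -> sums a f -> sums (dcoef a) g ->
  normc z < 1 -> hasd f z (g z).
Proof.
move=> at_ af ag z1; set x := normc z; have x0 : 0 <= x := normc_ge0 z.
(* |z| < rho < r < 1 with equal steps eta: increments up to eta stay within rho,
   and Cauchy's estimates are taken at r. *)
pose eta := (1 - x) / 4.
have eta0 : 0 < eta by rewrite /eta /x; lra.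
pose rho := x + eta; pose r := rho + eta.
have r01 : 0 < r < 1 by rewrite /r /rho /eta /x in x0 z1 *; apply/andP; split; lra.
have /andP[r0 r1] := r01; have [M aM] := at_ r r01.
have rho0 : 0 <= rho by rewrite /rho; lra.
have q1 : 0 < 1 - rho / r by rewrite subr_gt0 ltr_pdivrMr // mul1r /r; lra.
have M0 : 0 <= M by apply: le_trans (aM 0%N); rewrite expr0 mulr1 normc_ge0.
pose B := M / (1 - rho / r) / eta ^+ 2.
have B0 : 0 <= B by rewrite /B !divr_ge0 ?exprn_ge0 // ltW.
have main w : normc (w - z) <= eta ->
    normc (f w - f z - g z * (w - z)) <= B * normc (w - z) ^+ 2.
  move=> we; have w1 : normc w < 1.
    have := ler_normcD (w - z) z; rewrite subrK -/x.
    by rewrite /r /rho in r1; lra.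
  pose proof (climB (climB (clim_shiftS (af w w1)) (clim_shiftS (af z z1)))
    (climM (ag z z1) (@clim_cst _ _ (\oo : set_system nat) _ (w - z)))) as L.
  apply: (clim_le _ L); apply: filterE => m /=.
  have -> : psum a m.+1 w - psum a m.+1 z - psum (dcoef a) m z * (w - z) =
      \sum_(k < m.+1) a k * (w ^+ k - z ^+ k - k%:R * (w - z) * z ^+ k.-1).
    rewrite /psum !big_ord_recl /= !expr0 mulr0n !mul0r !mulr1 subrr subr0 mulr0 add0r.
    have -> (s t : C) : a 0%N + s - (a 0%N + t) = s - t by ring.
    rewrite mulr_suml -!sumrB; apply: eq_bigr => k _ /=.
    by rewrite /dcoef /bump /= add1n; ring.
  apply: le_trans (normc_sum _ _ _) _.
  apply: le_trans (_ : \sum_(k < m.+1) (normc (w - z) / eta) ^+ 2 * (M * (rho / r) ^+ k) <= _).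
    apply: ler_sum => k _; rewrite normcM.
    have := @taylor_rem z (w - z) x eta k (lexx _) eta0 we.
    rewrite (_ : z + (w - z) = w); last by ring.
    rewrite -/rho => T.
    have T2 : normc (w ^+ k - z ^+ k - k%:R * (w - z) * z ^+ k.-1) <=
        (normc (w - z) / eta) ^+ 2 * rho ^+ k.
      apply: le_trans T _; apply: ler_wpM2l.
        by rewrite exprn_ge0 // divr_ge0 ?normc_ge0 ?(ltW eta0).
      rewrite -addrA gerDl -opprD oppr_le0 addr_ge0 ?exprn_ge0 //.
      by apply: mulr_ge0; [apply: mulr_ge0; [exact: ler0n|exact: ltW]|exact: exprn_ge0].
    apply: le_trans (ler_wpM2l (normc_ge0 _) T2) _.
    rewrite mulrCA; apply: ler_wpM2l.
      by rewrite exprn_ge0 // divr_ge0 ?normc_ge0 ?(ltW eta0).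
    have -> : rho ^+ k = r ^+ k * (rho / r) ^+ k.
      by rewrite -exprMn mulrC divfK // gt_eqF.
    by rewrite mulrA ler_wpM2r // exprn_ge0 // divr_ge0 // ltW.
  rewrite -mulr_sumr -mulr_sumr.
  have -> : B * normc (w - z) ^+ 2 =
      (normc (w - z) / eta) ^+ 2 * (M * (1 - rho / r)^-1).
    by rewrite /B; move: (1 - rho / r) q1 => t t0; field; lra.
  apply: ler_wpM2l; first by rewrite exprn_ge0 // divr_ge0 ?normc_ge0 ?(ltW eta0).
  apply: ler_wpM2l => //.
  rewrite -[leRHS]mul1r ler_pdivlMr // mulrC -opprB mulNr -subrX1 opprB.
  by rewrite gerBl exprn_ge0 // divr_ge0 // ltW.
move=> e e0; have B1 : 0 < B + 1 by lra.
exists (Num.min eta (e / (B + 1))); first by rewrite lt_min eta0 divr_gt0.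
move=> w; rewrite lt_min => /andP[w1 w2] /=; rewrite ltr_pdivlMr // in w2.
apply: le_trans (main w (ltW w1)) _; rewrite expr2 mulrA; apply: ler_wpM2r; first exact: normc_ge0.
by have := normc_ge0 (w - z); lra.
Qed.

Lemma sums_holo a f : tame a -> sums a f -> holo f.
Proof.
move=> at_ af z z1; have [g ag] := sums_exist (tame_dcoef at_).
by exists (g z); exact: sums_deriv ag z1.
Qed.

Lemma holo_deriv f : holo f -> exists2 g, holo g & forall z, normc z < 1 -> hasd f z (g z).
Proof.
move=> fh; have [a [at_ af _]] := taylor_sums fh.
have [g ag] := sums_exist (tame_dcoef at_); exists g.
  by apply: sums_holo ag; exact: tame_dcoef.
by move=> z z1; exact: sums_deriv ag z1.
Qed.

Lemma sums_deriv0 a f d : tame a -> sums a f -> hasd f 0 d -> d = a 1%N.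
Proof.
move=> at_ af fd; have [g ag] := sums_exist (tame_dcoef at_).
have H : hasd f 0 (g 0) by apply: sums_deriv ag _; rewrite ?normc0.
by rewrite (hasd_unique fd H) (sums0 ag) /dcoef mul1r.
Qed.

Definition icoef a (k : nat) : C := if k is j.+1 then a j / j.+1%:R else 0.

(** Integrate the Taylor series termwise. *)
Lemma holo_primitive f : holo f ->
  exists F, F 0 = 0 /\ forall z, normc z < 1 -> hasd F z (f z).
Proof.
move=> fh; have [a [at_ af _]] := taylor_sums fh.
have ia : tame (icoef a).
  move=> r r01; have [M aM] := at_ r r01; exists M; have /andP[r0 r1] := r01.
  have M0 : 0 <= M by apply: le_trans (aM 0%N); rewrite expr0 mulr1 normc_ge0.
  case=> [|k]; rewrite /icoef; first by rewrite normc0 mul0r.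
  have A0 : 0 <= normc (a k) * r ^+ k by rewrite mulr_ge0 ?normc_ge0 ?exprn_ge0 // ltW.
  rewrite normcM normcV normc_nat mulrAC ler_pdivrMr // exprSr mulrA.
  have k1 : 1 <= k.+1%:R :> R by rewrite ler1n.
  apply: ler_pM; rewrite ?(ltW r0) //; lra.
have [F HF] := sums_exist ia; exists F; split; first by rewrite (sums0 HF).
move=> z z1; apply: (sums_deriv ia HF) => //.
have -> : dcoef (icoef a) = a; last exact: af.
by apply/funext => k; rewrite /dcoef /icoef mulrC divfK // pnatr_eq0.
Qed.

(** Near 0 the first nonzero term dominates the rest of the series: zeros are
    isolated. *)
Lemma leading_term a f m : tame a -> sums a f -> (forall j, (j < m)%N -> a j = 0) ->
  a m != 0 -> exists2 rho : R, 0 < rho < 1 &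
    forall z, normc z < rho -> normc (a m) * normc z ^+ m / 2 <= normc (f z).
Proof.
move=> at_ af a0 am; have h01 : 0 < (2^-1 : R) < 1 by apply/andP; split; lra.
have [M aM] := at_ _ h01.
have M0 : 0 <= M by apply: le_trans (aM 0%N); rewrite expr0 mulr1 normc_ge0.
have am0 : 0 < normc (a m) by rewrite normc_gt0.
pose T := 4 * (M + 1) * 2 ^+ m.+1.
have T0 : 0 < T by rewrite /T mulr_gt0 ?exprn_gt0 // mulr_gt0 //; lra.
exists (Num.min 4^-1 (normc (a m) / T)).
  by rewrite lt_min divr_gt0 // gt_min; apply/andP; split; [|apply/orP; left]; lra.
move=> z; rewrite lt_min => /andP[z4 zT]; rewrite ltr_pdivlMr // in zT.
have z0 := normc_ge0 z.
have := @sums_tail a f 2^-1 M z m.+1 _ af aM; rewrite invrK.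
have -> : psum a m.+1 z = a m * z ^+ m.
  rewrite /psum big_ord_recr /= big1 ?add0r // => i _; by rewrite a0 ?mul0r.
have h1 : 0 < (2^-1 : R) <= 1 by apply/andP; split; lra.
have h2 : normc z < 2^-1 by lra.
move=> /(_ h1 h2) H.
have H1 := lerB_normc (a m * z ^+ m) (f z); rewrite normcBC in H1.
rewrite normcM normcX in H1.
suff : M * (normc z * 2) ^+ m.+1 / (1 - normc z * 2) <= normc (a m) * normc z ^+ m / 2 by lra.
rewrite ler_pdivrMr; last lra.
have zm : 0 <= normc z ^+ m by rewrite exprn_ge0.
have E : M * (normc z * 2) ^+ m.+1 <= normc z ^+ m * (normc (a m) / 4).
  apply: le_trans (_ : normc z ^+ m * (normc z * T / 4) <= _); last first.
    by rewrite ler_wpM2l //; lra.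
  have -> : normc z ^+ m * (normc z * T / 4) = (M + 1) * (normc z * 2) ^+ m.+1.
    by rewrite /T exprMn (exprS (normc z)); field.
  by rewrite ler_wpM2r ?exprn_ge0 ?mulr_ge0 //; lra.
apply: le_trans E _.
have A : 0 <= normc z ^+ m * normc (a m) by rewrite mulr_ge0 // ltW.
have := ler_wpM2l A (_ : 2^-1 <= 1 - normc z * 2); lra.
Qed.

Lemma sums_zero_coef a f : tame a -> sums a f ->
  (exists2 e : R, 0 < e & forall z, normc z < e -> f z = 0) -> forall k, a k = 0.
Proof.
move=> at_ af [e e0 f0] k; apply/eqP; apply: contrapT => /negP ak.
have ex : exists j, a j != 0 by exists k.
case: (ex_minnP ex) => m am mmin.
have [|rho /andP[rho0 _] H] := leading_term at_ af _ am.
  move=> j jm; apply/eqP; apply: contrapT => /negP /mmin; by rewrite leqNgt jm.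
pose t := Num.min rho e / 2.
have t0 : 0 < t by rewrite divr_gt0 // lt_min rho0.
have [tr te] : t < rho /\ t < e.
  have : Num.min rho e <= rho by rewrite ge_min lexx.
  have : Num.min rho e <= e by rewrite ge_min lexx orbT.
  by rewrite /t in t0 *; split; lra.
have nt : normc ((t%:C)%C : C) = t by rewrite normc_real ger0_norm // ltW.
have := H (t%:C)%C; rewrite nt f0 ?nt // normc0 => /(_ tr).
have : 0 < normc (a m) * t ^+ m / 2.
  by rewrite divr_gt0 // mulr_gt0 ?exprn_gt0 // normc_gt0.
lra.
Qed.

Lemma sums_const a f : sums a f -> (forall k, a k.+1 = 0) ->
  forall z, normc z < 1 -> f z = a 0%N.
Proof.
move=> af a0 z z1; apply: (clim_unique (clim_shiftS (af z z1))).
apply: clim_near_eq (@clim_cst _ _ (\oo : set_system nat) _ (a 0%N)).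
apply: filterE => n /=; rewrite /psum big_ord_recl /= expr0 mulr1 big1 ?addr0 //.
by move=> i _; rewrite /bump /= add1n a0 mul0r.
Qed.

Lemma deriv0_const f : (forall z, normc z < 1 -> hasd f z 0) ->
  forall z, normc z < 1 -> f z = f 0.
Proof.
move=> f0; have fh : holo f by move=> z /f0 H; exists 0.
have [a [at_ af _]] := taylor_sums fh.
have [g ag] := sums_exist (tame_dcoef at_).
have g0 z : normc z < 1 -> g z = 0.
  by move=> z1; apply: hasd_unique (sums_deriv at_ af ag z1) (f0 _ z1).
have c0 := sums_zero_coef (tame_dcoef at_) ag (ex_intro2 _ _ 1 ltr01 g0).
move=> z z1; rewrite (sums0 af) (sums_const af) // => k.
have /eqP := c0 k; rewrite /dcoef mulf_eq0 pnatr_eq0 /= => /eqP; exact.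
Qed.

(** The quotient f z / z is the series with shifted coefficients, so its
    singularity at 0 is removable. *)
Lemma holo_factor f d : holo f -> f 0 = 0 -> hasd f 0 d -> exists e,
  [/\ holo e, e 0 = d & forall z, normc z < 1 -> f z = z * e z].
Proof.
move=> fh f0 fd; have [a [at_ af _]] := taylor_sums fh.
pose b k := a k.+1.
have bt : tame b.
  move=> r r01; have [M aM] := at_ r r01; have /andP[r0 r1] := r01.
  by exists (M / r) => k; rewrite ler_pdivlMr // -mulrA -exprSr; exact: (aM k.+1).
have [e He] := sums_exist bt; exists e; split.
- exact: sums_holo He.
- by rewrite (sums0 He) (sums_deriv0 at_ af fd).
move=> z z1; apply: (clim_unique (clim_shiftS (af z z1))).
pose proof (climM (@clim_cst _ _ (\oo : set_system nat) _ z) (He z z1)) as L.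
apply: clim_near_eq L; apply: filterE => n /=.
rewrite /psum big_ord_recl /= -(sums0 af) f0 mul0r add0r mulr_sumr.
by apply: eq_bigr => i _; rewrite /bump /= add1n /b exprS; ring.
Qed.

Lemma center_le f r M : holo f -> 0 < r < 1 ->
  (forall w, normc w = r -> normc (f w) <= M) -> normc (f 0) <= M.
Proof.
move=> fh r01 fM; have [a [at_ af H]] := taylor_sums fh.
by have := H r M r01 fM 0%N; rewrite expr0 mulr1 (sums0 af).
Qed.

Lemma holoX f p : holo f -> holo (fun z => f z ^+ p).
Proof. by move=> fh z z1; apply: cdiffX; exact: fh. Qed.

(** Cauchy's estimate bounds f only up to a factor 1 / (1 - |z| / r).  Applied to
    f^p it bounds |f z| up to the p-th root of this factor. *)
Lemma max_principle f r M z : holo f -> 0 < r < 1 ->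
  (forall w, normc w = r -> normc (f w) <= M) -> normc z < r -> normc (f z) <= M.
Proof.
move=> fh r01 fM zr; have /andP[r0 r1] := r01; rewrite leNgt; apply/negP => Mf.
have M0 : 0 <= M.
  by apply: le_trans (fM ((r%:C)%C) _); rewrite ?normc_ge0 // normc_real ger0_norm // ltW.
have q1 : normc z / r < 1 by rewrite ltr_pdivrMr // mul1r.
suff : (1 : R) <= 0 by rewrite ler10.
have f0 : 0 < normc (f z) by lra.
apply: (@le_geom _ _ (M / normc (f z)) ((1 - normc z / r)^-1)).
  by rewrite divr_ge0 ?normc_ge0 //= ltr_pdivrMr // mul1r.
move=> p; have [a [_ Ha]] := taylor (holoX p fh).
have := Ha r (M ^+ p) r01; case=> [w wr|_ /(_ z 0%N zr)].
  by rewrite normcX lerXn2r ?nnegrE ?normc_ge0 // fM.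
rewrite /psum big_ord0 subr0 expr0 mulr1 normcX => H.
rewrite expr_div_n mulrA ler_pdivlMr ?exprn_gt0 // mul1r mulrC; exact: H.
Qed.

(** The maximum principle for f z / z on circles of radius tending to 1. *)
Lemma schwarz f : holo f -> f 0 = 0 -> (forall z, normc z < 1 -> normc (f z) <= 1) ->
  forall z, normc z < 1 -> normc (f z) <= normc z.
Proof.
move=> fh f0 f1 z z1.
have [d fd] : cdiff f 0 by apply: fh; rewrite normc0.
have [e [eh _ fe]] := holo_factor fh f0 fd.
rewrite leNgt; apply/negP => zf.
have z0 := normc_ge0 z; have fz0 : 0 < normc (f z) by lra.
have q1 : normc z / normc (f z) < 1 by rewrite ltr_pdivrMr // mul1r.
have q0 : normc z <= normc z / normc (f z).
  by rewrite ler_pdivlMr // ler_piMr // f1.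
pose r := (1 + normc z / normc (f z)) / 2.
have r01 : 0 < r < 1 by rewrite /r; apply/andP; split; lra.
have zr : normc z < r by rewrite /r; lra.
have /andP[r0 r1] := r01.
have H : normc (e z) <= r^-1.
  apply: (max_principle eh r01 _ zr) => w wr; have w1 : normc w < 1 by rewrite wr.
  have := f1 w w1; rewrite fe // normcM wr => H.
  by rewrite -[leRHS]mul1r ler_pdivlMr // mulrC.
have := fe z z1 => /(congr1 (@normc _)); rewrite normcM => E.
have H2 : normc (f z) <= normc z / r by rewrite E ler_wpM2l.
rewrite ler_pdivlMr // in H2.
have : normc z / normc (f z) < r by rewrite /r; lra.
by rewrite ltr_pdivrMr //; lra.
Qed.

(** L is the primitive of h' / h vanishing at 0: h exp(-L) has derivative 0. *)
Lemma holo_log h : holo h -> (forall z, normc z < 1 -> h z != 0) -> h 0 = 1 ->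
  exists L, [/\ holo L, L 0 = 0 & forall z, normc z < 1 -> h z = cexp (L z)].
Proof.
move=> hh hn h1; have [g gh hg] := holo_deriv hh.
have qh : holo (fun z => g z / h z).
  by move=> z z1; apply: cdiff_div; [exact: hn|exact: gh|exact: hh].
have [L [L0 Ld]] := holo_primitive qh; exists L; split => //.
  by move=> z /Ld H; exists (g z / h z).
move=> z z1; have K : forall w, normc w < 1 -> hasd (fun z => h z * cexp (- L z)) w 0.
  move=> w w1; have D := hasd_comp (hasdN (Ld w w1)) (hasd_cexp (- L w)).
  have := hasdM (hg w w1) D.
  have -> // : g w * cexp (- L w) + h w * (cexp (- L w) * - (g w / h w)) = 0.
  have := hn w w1 => hw; by field.
have := deriv0_const K z1; rewrite /= L0 oppr0 cexp0 h1 mulr1 cexpN => E.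
by rewrite -[LHS](divfK (cexp_neq0 (L z))) E mul1r.
Qed.

End PowerSeries.

(** * Univalent functions: local boundedness and Hurwitz's theorem *)

Section Univalent.
Variable R : realType.
Local Notation C := R[i].
Implicit Types (f g h : C -> C) (a b z w d : C) (r x M : R).

(** A minimizing sequence on the circle converges along an ultrafilter. *)
Lemma circle_min f r : 0 < r -> (forall w, normc w <= r -> ccont f w) ->
  exists2 z0, normc z0 = r & forall w, normc w = r -> normc (f z0) <= normc (f w).
Proof.
move=> r0 fc; pose S : set R := [set normc (f w) | w in [set w | normc w = r]].
have S0 : has_inf S.
  split; last by exists 0 => _ [w _ <-]; exact: normc_ge0.
  exists (normc (f (r%:C)%C)), (r%:C)%C => //.
  by rewrite /mkset normc_real ger0_norm // ltW.
have H (n : nat) : exists w, normc w = r /\ normc (f w) < inf S + n.+1%:R^-1.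
  have n0 : 0 < n.+1%:R^-1 :> R by rewrite invr_gt0.
  by have [_ [w wr <-] H] := inf_adherent n0 S0; exists w.
have [u Hu] := choice H.
have [U [UU sU]] := @ultraFilterLemma _ (\oo : set_system nat) _.
have UP : ProperFilter U := @ultra_proper _ _ UU.
have ub : U [set n | normc (u n) <= r].
  by apply: sU; exists 0%N => // n _ /=; have [-> _] := Hu n.
have [l ul] := ultra_clim UU ub.
have lr := clim_le (FF := UP) ub ul.
have rl : r <= normc l.
  apply/ler_addgt0Pr => e e0; have [n /= un] := filter_ex (ul _ e0).
  by have := lerB_normc (u n) l; have [-> _] := Hu n; lra.
exists l; first by apply/eqP; rewrite eq_le lr rl.
move=> w wr; apply: le_trans (_ : inf S <= _); last first.
  by apply: ge_inf; [by case: S0|exists w].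
apply/ler_addgt0Pr => e e0; have e2 : 0 < e / 2 by lra.
have [d d0 Hd] := ccont_ex (fc _ lr) e2.
have [N HN] : exists N : nat, N.+1%:R^-1 < e / 2.
  exists (Num.bound (e / 2)^-1); rewrite invf_plt ?posrE //.
  apply: lt_trans (_ : (Num.bound (e / 2)^-1)%:R < _); last by rewrite ltr_nat.
  by apply: archi_boundP; rewrite invr_ge0 ltW.
have V : U [set n | (N <= n)%N] by apply: sU; exists N.
have [n [/= Nn /Hd fn]] := filter_ex (filterI V (ul _ d0)).
have [_ H1] := Hu n.
have H2 : n.+1%:R^-1 <= N.+1%:R^-1 :> R by rewrite lef_pV2 ?posrE // ler_nat.
move: HN H1 H2; move: (n.+1%:R^-1) (N.+1%:R^-1) => s t HN H1 H2.
by have := lerB_normc (f l) (f (u n)); rewrite (normcBC (f l)); lra.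
Qed.

Definition inj_disk f := forall z w, normc z < 1 -> normc w < 1 -> f z = f w -> z = w.

Definition normalized_univalent f := [/\ holo f, inj_disk f, f 0 = 0 & hasd f 0 1].

Lemma holo_scale f (c : C) : normc c <= 1 -> holo f -> holo (fun z => f (c * z)).
Proof.
move=> c1 fh z z1; have cz : normc (c * z) < 1.
  by rewrite normcM; apply: le_lt_trans z1; rewrite ler_piMl ?normc_ge0.
apply: (@cdiff_comp _ (fun z => c * z)); last exact: fh.
by apply: cdiffM; [exact: cdiff_cst|exact: cdiff_id].
Qed.

(** The least value w0 of f on the circle in modulus is omitted inside by
    injectivity.  As f z = z e z with e without zeros, the maximum principle
    for 1 / e, bounded by r / |w0| on the circle, gives both estimates: at 0,
    where e 0 = 1, and at z. *)
Lemma omitted_value f r : normalized_univalent f -> 0 < r < 1 -> exists w0, [/\ w0 != 0, normc w0 <= 1,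
  forall z, normc z < r -> f z != w0 &
  forall z, normc z < r -> normc w0 * normc z <= r * normc (f z)].
Proof.
move=> [fh fi f0 fd] r01; have /andP[r0 r1] := r01.
have n0 : normc (0 : C) < 1 by rewrite normc0.
have fn z : normc z < 1 -> z != 0 -> f z != 0.
  move=> z1 z0; apply/eqP => fz; move/eqP: z0; apply.
  by apply: fi => //; rewrite fz f0.
have [e [eh e0 fe]] := holo_factor fh f0 fd.
have en z : normc z < 1 -> e z != 0.
  have [-> _|z0 z1] := eqVneq z 0; first by rewrite e0 oner_eq0.
  by have := fn z z1 z0; rewrite fe // mulf_eq0 negb_or => /andP[].
have [z0 z0r zmin] : exists2 z0, normc z0 = r &
    forall w, normc w = r -> normc (f z0) <= normc (f w).
  by apply: circle_min => // w wr; apply/cdiff_cont/fh; lra.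
have z01 : normc z0 < 1 by lra.
have w0n : 0 < normc (f z0).
  by rewrite normc_gt0 fn // -normc_gt0 z0r.
have ieh : holo (fun z => (e z)^-1).
  by move=> z z1; apply: cdiffV; [exact: en|exact: eh].
have ie w : normc w = r -> normc (e w)^-1 <= r / normc (f z0).
  move=> wr; have w1 : normc w < 1 by rewrite wr.
  have ew : 0 < normc (e w) by rewrite normc_gt0 en.
  rewrite normcV ler_pdivlMr // mulrC ler_pdivrMr // mulrC.
  have := zmin w wr; rewrite (fe w w1) normcM wr mulrC; lra.
exists (f z0); split.
- by rewrite -normc_gt0.
- have := center_le ieh r01 ie; rewrite e0 invr1 normc1 ler_pdivlMr // mul1r; lra.
- move=> z zr; apply/eqP => E; have : z = z0 by apply: fi => //; lra.
  by move=> zz; rewrite zz z0r ltxx in zr.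
- move=> z zr; have z1 : normc z < 1 by lra.
  have := max_principle ieh r01 ie zr.
  have ew : 0 < normc (e z) by rewrite normc_gt0 en.
  rewrite normcV ler_pdivlMr // mulrC ler_pdivrMr // => H.
  rewrite (fe z z1) normcM (mulrC (normc z)) mulrA ler_wpM2r ?normc_ge0 //.
Qed.

(** Suppose h z is close to -1, and put p = - h z.  On the circle of radius 1/2
    one has |1 - h| |1 + h| = |F / w0| >= 1/2, which keeps h away from 1 and
    from p.  If h did not take the value p, the maximum principle for
    1 / (h - p) would contradict that h 0 = 1 is closer to p.  So h w = - h z
    for some w, whence F w = F z, w = z and h z = 0, which is impossible for
    an exponential. *)
Lemma sqrt_transform F (w0 : C) : holo F -> inj_disk F -> F 0 = 0 -> w0 != 0 ->
  (forall z, normc z < 1 -> F z != w0) ->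
  (forall z, normc z < 1 -> normc w0 * normc z <= normc (F z)) ->
  exists h, [/\ holo h, h 0 = 1,
    forall z, normc z < 1 -> h z ^+ 2 = 1 - F z / w0 &
    forall z, normc z < 1 -> 10^-1 <= normc (h z + 1)].
Proof.
move=> Fh Fi F0 w00 Fn FB.
have uh : holo (fun z => 1 - F z / w0).
  move=> z z1; apply: cdiffB; first exact: cdiff_cst.
  by apply: cdiffM; [exact: Fh|exact: cdiff_cst].
have [||L [Lh L0 HL]] := holo_log uh.
- move=> z z1; rewrite subr_eq0; apply/eqP => E; have := Fn z z1.
  by rewrite -[F z](divfK w00) -E mul1r eqxx.
- by rewrite F0 mul0r subr0.
have hh : holo (fun z => cexp (L z / 2)).
  move=> z z1; apply: (@cdiff_comp _ (fun z => L z / 2)); last exact: cdiff_cexp.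
  by apply: cdiffM; [exact: Lh|exact: cdiff_cst].
have h2 z : normc z < 1 -> cexp (L z / 2) ^+ 2 = 1 - F z / w0.
  by move=> z1; rewrite (HL z z1) expr2 -cexpD; congr cexp; field.
exists (fun z => cexp (L z / 2)); split => //.
  by rewrite L0 mul0r cexp0.
move=> z z1; rewrite leNgt; apply/negP => small.
pose p := - cexp (L z / 2).
have p1 : normc (1 - p) < 10^-1 by rewrite /p opprK addrC.
have pn w : normc w < 1 -> cexp (L w / 2) - p != 0.
  move=> w1; rewrite /p opprK; apply/eqP => E.
  have E2 : cexp (L w / 2) = - cexp (L z / 2).
    by apply/eqP; rewrite -subr_eq0 opprK E.
  have E3 : 1 - F w / w0 = 1 - F z / w0 by rewrite -!h2 // E2 sqrrN.
  have E4 : F w = F z.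
    rewrite -[F w](divfK w00) -[F z](divfK w00); congr (_ * _).
    by apply: oppr_inj; apply: (addrI 1).
  have wz := Fi _ _ w1 z1 E4; move: E; rewrite wz => /eqP.
  by rewrite -mulr2n mulrn_eq0 /= (negbTE (cexp_neq0 _)).
have qh : holo (fun w => (cexp (L w / 2) - p)^-1).
  move=> w w1; apply: cdiffV; first exact: pn.
  by apply: cdiffB; [exact: hh|exact: cdiff_cst].
have h01 : 0 < (2^-1 : R) < 1 by apply/andP; split; lra.
have qb w : normc w = 2^-1 -> normc (cexp (L w / 2) - p)^-1 <= 10.
  move=> w2; have w1 : normc w < 1 by lra.
  have FW : 2^-1 <= normc (F w / w0).
    rewrite normcM normcV ler_pdivlMr ?normc_gt0 // mulrC -w2; exact: FB.
  set H := cexp (L w / 2); have H2 : H ^+ 2 = 1 - F w / w0 by exact: h2.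
  have E : F w / w0 = (1 - H) * (H + 1).
    by have -> : F w / w0 = 1 - H ^+ 2; [rewrite H2; ring|ring].
  have n1 : normc (H + 1) <= normc (1 - H) + 2.
    have -> : H + 1 = - (1 - H) + 2%:R by ring.
    by apply: le_trans (ler_normcD _ _) _; rewrite normc_opp normc_nat.
  have n0 := normc_ge0 (1 - H).
  have H5 : 5^-1 <= normc (1 - H).
    rewrite leNgt; apply/negP => lt5; rewrite E normcM in FW.
    have := ler_pM n0 (normc_ge0 (H + 1)) (ltW lt5) n1; lra.
  have Hp : 10^-1 <= normc (H - p).
    have := ler_normc_tri p 1 H; rewrite (normcBC p); lra.
  rewrite normcV -[leRHS]invrK lef_pV2 ?posrE //; lra.
have := center_le qh h01 qb; rewrite L0 mul0r cexp0 normcV => H.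
have p0 : 0 < normc (1 - p).
  by rewrite normc_gt0; have := pn 0; rewrite L0 mul0r cexp0 normc0 => /(_ ltr01).
have H' : 10^-1 <= normc (1 - p).
  by rewrite -lef_pV2 ?posrE ?invrK // invr_gt0.
by have := le_lt_trans H' p1; rewrite ltxx.
Qed.

(** (h + 1) / 2 = exp L with L 0 = 0 and Re L >= - A, where e^A = 20.  The map
    u |-> u / (2 A + u) sends this half-plane into the unit disk, so Schwarz's
    lemma bounds L, hence h. *)
Lemma caratheodory_bound h x z : holo h -> h 0 = 1 ->
  (forall z, normc z < 1 -> 10^-1 <= normc (h z + 1)) ->
  0 < x < 1 -> normc z <= x ->
  normc (h z + 1) <= 2 * expR (2 * ln 20 * x / (1 - x)).
Proof.
move=> hh h0 hb /andP[x0 x1] zx; pose A : R := ln 20.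
have A0 : 0 < A by rewrite ln_gt0 //; lra.
have vh : holo (fun z => (h z + 1) / 2).
  move=> w w1; apply: cdiffM; last exact: cdiff_cst.
  by apply: cdiffD; [exact: hh|exact: cdiff_cst].
have two0 : (2 : C) != 0 by rewrite pnatr_eq0.
have [||L [Lh L0 HL]] := holo_log vh.
- move=> w w1; rewrite mulf_neq0 ?invr_neq0 // -normc_gt0.
  by have := hb w w1; lra.
- by rewrite h0 -[1 + 1]/(2%:R : C) divff.
have LA w : normc w < 1 -> - A <= complex.Re (L w).
  move=> w1; rewrite -ler_expR -normc_cexp -HL // normcM normcV normc_nat.
  by rewrite expRN lnK ?posrE //; have := hb w w1; lra.
have AL w : normc w < 1 -> (2 * A)%:C%C + L w != 0.
  move=> w1; apply/eqP => /(congr1 (@complex.Re _)); rewrite raddfD /=.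
  by have := LA w w1; lra.
pose p w := L w / ((2 * A)%:C%C + L w).
have ph : holo p.
  move=> w w1; apply: cdiff_div; [exact: AL|exact: Lh|].
  by apply: cdiffD; [exact: cdiff_cst|exact: Lh].
have p0 : p 0 = 0 by rewrite /p L0 mul0r.
have p1 w : normc w < 1 -> normc (p w) <= 1.
  move=> w1; rewrite /p normcM normcV ler_pdivrMr ?normc_gt0 ?AL // mul1r.
  rewrite -(@ler_pXn2r _ 2) ?nnegrE ?normc_ge0 // !normc_sqr.
  have := LA w w1; case: (L w) => s t /= H; rewrite add0r lerD2r; nra.
have z1 : normc z < 1 by lra.
have := schwarz ph p0 p1 z1 => pz.
have {}pz : normc (p z) <= x by lra.
have n0 := normc_ge0 (L z).
have Lz : normc (L z) <= 2 * A * x / (1 - x).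
  have E : L z = p z * ((2 * A)%:C%C + L z) by rewrite /p divfK // AL.
  have A2 : normc ((2 * A)%:C%C + L z) <= 2 * A + normc (L z).
    apply: le_trans (ler_normcD _ _) _; rewrite normc_real ger0_norm //; lra.
  have := ler_pM (normc_ge0 _) (normc_ge0 _) pz A2; rewrite -normcM -E => H.
  rewrite ler_pdivlMr; lra.
have -> : h z + 1 = 2%:R * cexp (L z) by rewrite -HL // mulrC divfK.
rewrite normcM normc_nat normc_cexp ler_wpM2l // ler_expR.
by apply: le_trans Lz; apply: le_trans (Re_le_normc _); exact: ler_norm.
Qed.

(** The previous lemmas are applied to f on the disk of radius r, rescaled.  With
    r = (1 + s) / 2 one has s <= r^2, so a point of modulus at most s is r y
    with |y| <= r. *)
Theorem growth s : 0 < s < 1 ->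
  exists M : R, forall f, normalized_univalent f -> forall z, normc z <= s -> normc (f z) <= M.
Proof.
move=> /andP[s0 s1]; pose r := (1 + s) / 2.
have r01 : 0 < r < 1 by rewrite /r; apply/andP; split; lra.
have /andP[r0 r1] := r01.
pose B := 2 * expR (2 * ln 20 * r / (1 - r)).
have B0 : 0 <= B by rewrite /B mulr_ge0 // expR_ge0.
exists (1 + (B + 1) ^+ 2) => f fu z zs.
have [w0 [w00 w01 fn fB]] := omitted_value fu r01.
have [fh fi f0 fd] := fu.
have nr : normc ((r%:C)%C : C) = r by rewrite normc_real ger0_norm // ltW.
have sc y : normc y < 1 -> normc ((r%:C)%C * y) < r.
  by move=> y1; rewrite normcM nr -[ltRHS]mulr1 ltr_pM2l.
have rC0 : (r%:C)%C != 0 :> C by rewrite -normc_gt0 nr.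
have [||||||h [hh h0 h2 hb]] := @sqrt_transform (fun y => f ((r%:C)%C * y)) w0.
- by apply: holo_scale => //; rewrite nr ltW.
- move=> y y' y1 y1' E; apply: (mulfI rC0); apply: fi => //.
    by have := sc y y1; lra.
  by have := sc y' y1'; lra.
- by rewrite mulr0.
- by [].
- by move=> y y1; apply: fn; exact: sc.
- move=> y y1; have := fB _ (sc y y1); rewrite normcM nr mulrCA ler_pM2l //.
pose y := z / (r%:C)%C.
have yr : normc y <= r.
  rewrite /y normcM normcV nr ler_pdivrMr //; apply: le_trans zs _.
  by have := sqr_ge0 (1 - s); rewrite /r; lra.
have y1 : normc y < 1 by lra.
have zy : z = (r%:C)%C * y by rewrite /y mulrC divfK.
have hB := caratheodory_bound hh h0 hb r01 yr; rewrite -/B in hB.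
have hB2 : normc (h y) <= B + 1.
  by have := ler_normcB (h y + 1) 1; rewrite addrK normc1; lra.
have E := h2 y y1; rewrite /= -zy in E.
have -> : f z = w0 * (1 - h y ^+ 2) by rewrite E; field.
rewrite normcM; have n2 := normc_ge0 (1 - h y ^+ 2).
apply: le_trans (ler_piMl n2 w01) _.
apply: le_trans (ler_normcB _ _) _; rewrite normc1 normcX lerD2l.
by rewrite lerXn2r ?nnegrE ?normc_ge0 //; lra.
Qed.

(** The automorphism of the disk sending 0 to b.  It allows every expansion to be
    made at the center: an analytic function on the disk that is constant near
    b becomes one that is constant near 0, hence constant, with no continuation
    along paths. *)
Definition mob b z : C := (z + b) / (1 + (b^*)%C * z).

(** The identity behind the invariance of the disk. *)
Lemma mob_sqr b z : normc (1 + (b^*)%C * z) ^+ 2 - normc (z + b) ^+ 2 =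
  (1 - normc z ^+ 2) * (1 - normc b ^+ 2).
Proof.
by rewrite !normc_sqr; case: b => c e; case: z => p q /=; ring.
Qed.

Lemma sqr_lt1 z : normc z < 1 -> 0 < 1 - normc z ^+ 2.
Proof.
move=> z1; have := normc_ge0 z => z0; rewrite subr_gt0 expr2.
by apply: (le_lt_trans _ z1); rewrite ler_piMl // ltW.
Qed.

Lemma mob_den b z : normc b < 1 -> normc z < 1 -> 1 + (b^*)%C * z != 0.
Proof.
move=> b1 z1; rewrite -normc_gt0 lt_neqAle normc_ge0 andbT; apply/eqP => E.
have := mob_sqr b z; rewrite -E => H.
have := mulr_gt0 (sqr_lt1 z1) (sqr_lt1 b1).
by have := sqr_ge0 (normc (z + b)); lra.
Qed.

(** Compact subdisks are sent into compact subdisks, so locally uniform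
    approximation survives recentering. *)
Lemma mob_radius b z x : normc b < 1 -> normc z <= x -> x < 1 ->
  normc (mob b z) <= 1 - (1 - x ^+ 2) * (1 - normc b ^+ 2) / 8.
Proof.
move=> b1 zx x1; have z0 := normc_ge0 z; have z1 : normc z < 1 by lra.
have D := mob_den b1 z1; have D0 : 0 < normc (1 + (b^*)%C * z) by rewrite normc_gt0.
have cb : normc (b^*)%C = normc b by case: (b) => p q /=; rewrite sqrrN.
have D2 : normc (1 + (b^*)%C * z) <= 2.
  apply: le_trans (ler_normcD _ _) _; rewrite normc1 normcM cb.
  by have := ler_pM (normc_ge0 b) z0 (ltW b1) (ltW z1); lra.
have B0 := sqr_lt1 b1; have Z0 := sqr_lt1 z1.
set k := (1 - x ^+ 2) * (1 - normc b ^+ 2).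
have xz : normc z ^+ 2 <= x ^+ 2 by rewrite lerXn2r ?nnegrE //; lra.
have k1 : k <= (1 - normc z ^+ 2) * (1 - normc b ^+ 2).
  by apply: ler_wpM2r; lra.
have x2 : 0 <= 1 - x ^+ 2.
  by rewrite subr_ge0; apply: exprn_ile1; lra.
have k0 : 0 <= k by rewrite /k mulr_ge0 // ltW.
have kle : k <= 1.
  have := sqr_ge0 x; have := sqr_ge0 (normc b) => bb xx.
  have h1 : 1 - x ^+ 2 <= 1 by lra.
  have h2 : 1 - normc b ^+ 2 <= 1 by lra.
  by have := ler_pM x2 (ltW B0) h1 h2; rewrite mulr1.
rewrite normcM normcV ler_pdivrMr //.
rewrite -(@ler_pXn2r _ 2) ?nnegrE ?normc_ge0 //; last first.
  by rewrite mulr_ge0 ?normc_ge0 //; lra.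
have -> : normc (z + b) ^+ 2 = normc (1 + (b^*)%C * z) ^+ 2 -
   (1 - normc z ^+ 2) * (1 - normc b ^+ 2) by rewrite -mob_sqr; ring.
move: D0 D2 k1 k0; set N := normc (1 + _); set T := _ * _ => D0 D2 k1 k0.
have N4 : N ^+ 2 <= 4.
  by have := ler_pM (ltW D0) (ltW D0) D2 D2; rewrite expr2; lra.
have A := ler_wpM2r k0 N4.
have B := mulr_ge0 (sqr_ge0 N) (sqr_ge0 (k / 8)).
by rewrite exprMn; lra.
Qed.

Lemma mob_lt1 b z : normc b < 1 -> normc z < 1 -> normc (mob b z) < 1.
Proof.
move=> b1 z1; apply: le_lt_trans (mob_radius b1 (lexx _) z1) _.
by have := mulr_gt0 (sqr_lt1 z1) (sqr_lt1 b1); lra.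
Qed.

Lemma mobK b z : normc b < 1 -> normc z < 1 -> mob b (mob (- b) z) = z.
Proof.
move=> b1 z1; have nb1 : normc (- b) < 1 by rewrite normc_opp.
have D := mob_den nb1 z1; have D2 := mob_den b1 (mob_lt1 nb1 z1).
have bb : 1 - (b^*)%C * b != 0.
  by have := mob_den nb1 b1; rewrite rmorphN mulNr.
rewrite /mob rmorphN mulNr in D D2 *.
have -> : 1 + (b^*)%C * ((z - b) / (1 - (b^*)%C * z)) =
    (1 - (b^*)%C * b) / (1 - (b^*)%C * z) by field.
by field; rewrite D bb.
Qed.

Lemma mob_inj b z w : normc b < 1 -> normc z < 1 -> normc w < 1 ->
  mob b z = mob b w -> z = w.
Proof.
move=> b1 z1 w1 E; have nb1 : normc (- b) < 1 by rewrite normc_opp.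
by rewrite -(mobK nb1 z1) -(mobK nb1 w1) opprK E.
Qed.

Lemma mob0 b : mob b 0 = b.
Proof. by rewrite /mob add0r mulr0 addr0 divr1. Qed.

Lemma holo_mob f b : normc b < 1 -> holo f -> holo (f \o mob b).
Proof.
move=> b1 fh z z1; apply: cdiff_comp; last by apply: fh; exact: mob_lt1.
apply: cdiff_div; first exact: mob_den.
  by apply: cdiffD; [exact: cdiff_id|exact: cdiff_cst].
apply: cdiffD; first exact: cdiff_cst.
by apply: cdiffM; [exact: cdiff_cst|exact: cdiff_id].
Qed.

(** Suppose g a = g b with a <> b.  After recentering at b, G - G 0 has an isolated
    zero at 0, so |G - G 0| >= dl on a small circle that does not enclose
    a', the new position of a.  For f close to g and F its recentering, F - F a'
    is small at 0, is not small on the circle, and has no zero in the disk of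
    radius |a'| since f is injective.  This contradicts the maximum principle
    for 1 / (F - F a'). *)
Theorem hurwitz g : holo g -> hasd g 0 1 ->
  (forall s e : R, 0 < s < 1 -> 0 < e -> exists f,
     [/\ holo f, inj_disk f & forall z, normc z <= s -> normc (f z - g z) < e]) ->
  inj_disk g.
Proof.
move=> gh gd H a b a1 b1 gab; apply/eqP; apply: contrapT => /negP ab.
have nb1 : normc (- b) < 1 by rewrite normc_opp.
pose G := g \o mob b; have Gh : holo G := holo_mob b1 gh.
pose a' := mob (- b) a; have a'1 : normc a' < 1 := mob_lt1 nb1 a1.
have ma' : mob b a' = a := mobK b1 a1.
have a'0 : a' != 0.
  by apply/eqP => E; move: ma'; rewrite E mob0 => ba; rewrite ba eqxx in ab.
have na' : 0 < normc a' by rewrite normc_gt0.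
have Gh0 : holo (fun z => G z - G 0).
  by move=> z z1; apply: cdiffB; [exact: Gh|exact: cdiff_cst].
have [c [ct cG _]] := taylor_sums Gh0.
have [ex|nex] := pselect (exists m, c m != 0); last first.
  have c0 k : c k = 0 by apply/eqP; apply: contrapT => /negP ck; apply: nex; exists k.
  have gc z : normc z < 1 -> g z = G 0.
    move=> z1; have mz := mob_lt1 nb1 z1.
    have := sums_const cG (fun k => c0 k.+1) mz; rewrite c0 => /eqP.
    by rewrite subr_eq0 /G /= mobK // => /eqP.
  have : hasd g 0 0.
    apply: hasd_near_eq (hasd_cst (G 0) 0); exists 1 => // w; rewrite subr0 => w1.
    by rewrite /= gc.
  by move=> /(hasd_unique gd) /eqP; rewrite oner_eq0.
case: (ex_minnP ex) => m cm mmin.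
have [|rho /andP[rho0 rho1] LT] := leading_term ct cG _ cm.
  by move=> j jm; apply/eqP; apply: contrapT => /negP /mmin; rewrite leqNgt jm.
(* The circle of radius t lies where the leading term dominates and does not
   reach a'. *)
pose t := Num.min rho (normc a') / 2.
have mt : 0 < Num.min rho (normc a') by rewrite lt_min rho0.
have mt1 : Num.min rho (normc a') <= rho by rewrite ge_min lexx.
have mt2 : Num.min rho (normc a') <= normc a' by rewrite ge_min lexx orbT.
have [t0 tr ta] : [/\ 0 < t, t < rho & t < normc a'] by rewrite /t; split; lra.
pose dl := normc (c m) * t ^+ m / 2.
have dl0 : 0 < dl by rewrite divr_gt0 // mulr_gt0 ?exprn_gt0 // normc_gt0.
have Gt z : normc z = t -> dl <= normc (G z - G 0).
  by move=> zt; rewrite /dl -zt; apply: LT; rewrite zt.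
have t1 : t < 1 by lra.
pose k := (1 - t ^+ 2) * (1 - normc b ^+ 2) / 8.
have t2 : 0 < 1 - t ^+ 2.
  by have := @sqr_lt1 (t%:C)%C; rewrite normc_real (ger0_norm (ltW t0)) => /(_ t1).
have k0 : 0 < k by rewrite /k divr_gt0 // mulr_gt0 // sqr_lt1.
pose s := Num.max (Num.max (normc a) (normc b)) (Num.max (1 - k) 2^-1).
have s01 : 0 < s < 1.
  rewrite /s !gt_max !lt_max a1 b1 /=; apply/andP; split; last by apply/andP; split; lra.
  by apply/orP; right; apply/orP; right; lra.
have [as_ bs ks] : [/\ normc a <= s, normc b <= s & 1 - k <= s].
  by rewrite /s !le_max !lexx ?orbT.
have dl4 : 0 < dl / 4 by lra.
have [f [fh fi fg]] := H s (dl / 4) s01 dl4.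
pose F := f \o mob b; have Fh : holo F := holo_mob b1 fh.
have Fa : normc (F a' - G a') < dl / 4 by rewrite /F /G /= ma'; exact: fg.
have GG : G a' = G 0 by rewrite /G /= ma' mob0 gab.
have Ft z : normc z = t -> dl / 2 <= normc (F z - F a').
  move=> zt; have h1 : normc (F z - G z) < dl / 4.
    by apply: fg; apply: le_trans ks; apply: mob_radius; rewrite ?zt.
  have := ler_normc_tri (F z) (G z) (G a'); have := ler_normc_tri (F a') (F z) (G a').
  by have := Gt z zt; rewrite -GG (normcBC (G z) (F z)); lra.
(* Rescaling by |a'| makes the reciprocal of F - F a' holomorphic on the whole
   unit disk. *)
have nC : normc ((normc a')%:C%C : C) = normc a' by rewrite normc_real ger0_norm // ltW.
have den z : normc z < 1 -> F ((normc a')%:C%C * z) - F a' != 0.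
  move=> z1; rewrite subr_eq0; apply/eqP => E.
  have lt : normc ((normc a')%:C%C * z) < normc a'.
    by rewrite normcM nC -[ltRHS]mulr1 ltr_pM2l.
  have lt1 : normc ((normc a')%:C%C * z) < 1 by lra.
  have : (normc a')%:C%C * z = a'.
    by apply: (mob_inj b1 lt1 a'1); apply: fi E; exact: mob_lt1.
  by move=> E2; rewrite E2 ltxx in lt.
have Hh : holo (fun z => (F ((normc a')%:C%C * z) - F a')^-1).
  move=> z z1; apply: cdiffV; first exact: den.
  apply: cdiffB; last exact: cdiff_cst.
  by apply: (@holo_scale F) => //; rewrite nC ltW.
have ta01 : 0 < t / normc a' < 1 by rewrite divr_gt0 //= ltr_pdivrMr // mul1r.
have Hb z : normc z = t / normc a' ->
    normc (F ((normc a')%:C%C * z) - F a')^-1 <= (dl / 2)^-1.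
  move=> zt; have zt' : normc ((normc a')%:C%C * z) = t.
    by rewrite normcM nC zt mulrC divfK // gt_eqF.
  have Q := Ft _ zt'; rewrite normcV lef_pV2 ?posrE //; lra.
have := center_le Hh ta01 Hb; rewrite mulr0 normcV.
have F0 : normc (F 0 - F a') < dl / 2.
  have h1 : normc (F 0 - G 0) < dl / 4 by rewrite /F /G /= mob0; exact: fg.
  by have := ler_normc_tri (G 0) (F 0) (F a'); rewrite -{2}GG (normcBC (G a')); lra.
have n0 : normc (0 : C) < 1 by rewrite normc0.
have P0 : 0 < normc (F 0 - F a').
  by rewrite normc_gt0; have := den 0 n0; rewrite mulr0.
rewrite lef_pV2 ?posrE //; lra.
Qed.

End Univalent.

(** * Ultrafilter limits of univalent functions *)

Section UnivalentLimit.
Variable R : realType.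
Local Notation C := R[i].
Implicit Types (f g h : C -> C) (z w d : C) (r x M : R).

Lemma filter_forall_lt (T : Type) (F : set_system T) {FF : Filter F}
  (P : nat -> set T) m :
  (forall k, F (P k)) -> F [set t | forall k, (k < m)%N -> P k t].
Proof.
move=> FP; elim: m => [|m IH]; first by apply: filterE => t k.
apply: filterS2 IH (FP m) => t H1 H2 k /=; rewrite ltnS leq_eqVlt => /orP[/eqP ->//|].
exact: H1.
Qed.

(** The family is indexed by an arbitrary type so that the statement does not
    depend on how functions on the disk are represented. *)
Theorem univalent_ultra_limit (T : Type) (F : set_system T) (Phi : T -> C -> C) :
  UltraFilter F -> F [set t | normalized_univalent (Phi t)] ->
  exists2 g, normalized_univalent g & forall s e : R, 0 < s < 1 -> 0 < e ->
    F [set t | forall z, normc z <= s -> normc (Phi t z - g z) < e].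
Proof.
move=> FU FS; have FP : ProperFilter F := @ultra_proper _ _ FU.
have HA f : exists ca : nat -> C, holo f -> [/\ tame ca, sums ca f &
  forall r M, 0 < r < 1 -> (forall w, normc w = r -> normc (f w) <= M) ->
    forall k, normc (ca k) * r ^+ k <= M].
  have [fh|nfh] := pselect (holo f); last by exists (fun=> 0).
  by have [ca Ha] := taylor_sums fh; exists ca.
have [A HA'] := choice HA.
have cb r : 0 < r < 1 -> exists M, forall f, normalized_univalent f -> forall k, normc (A f k) * r ^+ k <= M.
  move=> r01; have [M HM] := growth r01; exists M => f fu k.
  have [fh _ _ _] := fu; have [_ _ H] := HA' f fh.
  by apply: (H r M r01) => w wr; apply: HM => //; rewrite wr.
have Hb k : exists bk, clim F (fun t => A (Phi t) k) bk.
  have h01 : 0 < (2^-1 : R) < 1 by apply/andP; split; lra.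
  have [M HM] := cb _ h01; apply: (@ultra_clim _ _ _ _ (M / 2^-1 ^+ k)) => //.
  apply: filterS FS => t /= tu; rewrite ler_pdivlMr; [exact: HM|apply: exprn_gt0; lra].
have [cb' bA] := choice Hb.
have cbb r M : 0 < r -> (forall f, normalized_univalent f -> forall k, normc (A f k) * r ^+ k <= M) ->
    forall k, normc (cb' k) * r ^+ k <= M.
  move=> r0 HM k; rewrite -ler_pdivlMr ?exprn_gt0 //.
  apply: (clim_le (FF := FP) _ (bA k)); apply: filterS FS => t /= tu.
  by rewrite ler_pdivlMr ?exprn_gt0 //; exact: HM.
have bt : tame cb'.
  move=> r r01; have [M HM] := cb r r01; exists M; have /andP[r0 _] := r01.
  exact: cbb HM.
have [g bg] := sums_exist bt.
have unif (s e : R) : 0 < s < 1 -> 0 < e ->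
    F [set t | forall z, normc z <= s -> normc (Phi t z - g z) < e].
  move=> /andP[s0 s1] e0; pose r := (1 + s) / 2.
  have r01 : 0 < r < 1 by rewrite /r; apply/andP; split; lra.
  have /andP[r0 r1] := r01; have [M HM] := cb r r01.
  have bM := cbb r M r0 HM.
  have M0 : 0 <= M by apply: le_trans (bM 0%N); rewrite expr0 mulr1 normc_ge0.
  pose q := s / r.
  have q0 : 0 <= q by rewrite divr_ge0 // ltW.
  have q1 : q < 1 by rewrite ltr_pdivrMr // mul1r /r; lra.
  have q1' : 0 < 1 - q by lra.
  have /cvgrPdist_lt : (fun k => q ^+ k) @ \oo --> (0 : R).
    by apply: cvg_expr; rewrite ger0_norm.
  have M1 : 0 < M + 1 by lra.
  move=> /(_ (e * (1 - q) / (M + 1) / 4))[|m _ /(_ m (leqnn m))] /=.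
    by rewrite !divr_gt0 ?mulr_gt0.
  rewrite sub0r normrN ger0_norm ?exprn_ge0 // => qm.
  have tailb : M * q ^+ m / (1 - q) <= e / 4.
    rewrite ler_pdivrMr //.
    have : q ^+ m * (M + 1) <= e * (1 - q) / 4.
      by rewrite -ler_pdivlMr // mulrAC; exact: ltW.
    by have := exprn_ge0 m q0; lra.
  have em : 0 < e / 4 / m.+1%:R by rewrite !divr_gt0.
  pose proof (filter_forall_lt m (fun k => bA k _ em)) as FC.
  apply: filterS2 FS FC => t /= tu tc z zs.
  have [fh _ _ _] := tu; have [_ af _] := HA' _ fh.
  have z0 := normc_ge0 z.
  have zr : normc z < r by rewrite /r; lra.
  have r01' : 0 < r <= 1 by rewrite r0 ltW.
  have mono (ca : nat -> C) f : sums ca f -> (forall k, normc (ca k) * r ^+ k <= M) ->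
      normc (f z - psum ca m z) <= e / 4.
    move=> sa aM; apply: le_trans (sums_tail m r01' sa aM zr) _.
    apply: le_trans tailb; rewrite -!mulrA; apply: ler_wpM2l => //.
    have qz : normc z / r <= q by rewrite ler_pM2r ?invr_gt0.
    have qz0 : 0 <= normc z / r by rewrite divr_ge0 // ltW.
    apply: ler_pM; rewrite ?exprn_ge0 ?invr_ge0 //; first lra.
      by rewrite lerXn2r ?nnegrE.
    by rewrite lef_pV2 ?posrE; lra.
  have P1 := mono _ _ af (HM _ tu); have P2 := mono _ _ bg bM.
  have P3 : normc (psum (A (Phi t)) m z - psum cb' m z) <= e / 4.
    rewrite /psum -sumrB; apply: le_trans (normc_sum _ _ _) _.
    apply: le_trans (_ : \sum_(k < m) e / 4 / m.+1%:R <= _).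
      apply: ler_sum => k _; rewrite -mulrBl normcM normcX.
      rewrite -[leRHS]mulr1; apply: ler_pM; rewrite ?normc_ge0 ?exprn_ge0 //.
        by apply: ltW; apply: tc.
      by rewrite exprn_ile1 //; lra.
    rewrite sumr_const card_ord -[X in X <= _]mulr_natr -mulrA; apply: ler_piMr; first lra.
    by rewrite mulrC ler_pdivrMr // mul1r ler_nat.
  have := ler_normc_tri (psum (A (Phi t)) m z) (Phi t z) (g z).
  have := ler_normc_tri (psum cb' m z) (psum (A (Phi t)) m z) (g z).
  by rewrite (normcBC (psum cb' m z)); lra.
exists g => //; have gh := sums_holo bt bg.
have gd : hasd g 0 1.
  have [d Hd] : cdiff g 0 by apply: gh; rewrite normc0.
  suff <- : d = 1 by [].
  rewrite (sums_deriv0 bt bg Hd); apply: (clim_unique (FF := FP) (bA 1%N)).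
  apply: (clim_near_eq _ (@clim_cst _ _ F _ 1)); apply: filterS FS => t /= tu.
  have [fh _ _ fd] := tu; have [a1 a2 _] := HA' _ fh.
  exact: sums_deriv0 a1 a2 fd.
split => //.
- apply: (hurwitz gh gd) => s e s01 e0.
  have [t [/= [fh fi _ _] H]] := filter_ex (filterI FS (unif s e s01 e0)).
  by exists (Phi t).
- rewrite (sums0 bg); apply: (clim_unique (FF := FP) (bA 0%N)).
  apply: (clim_near_eq _ (@clim_cst _ _ F _ 0)); apply: filterS FS => t /= tu.
  have [fh _ f0 _] := tu; have [a1 a2 _] := HA' _ fh.
  by rewrite -(sums0 a2) f0.
Qed.

End UnivalentLimit.

(** * Complex derivatives and functions on the disk as library objects *)

Section DerivableEpsilon.
Variable K : numFieldType.

(** Stated over an arbitrary field of numbers; its instance at the complex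
    numbers turns the library derivative into [hasd]. *)
Lemma derivable_epsP (f : K^o -> K^o) (z d : K^o) :
  (derivable f z 1 /\ 'D_1 f z = d) <->
  forall e : K, 0 < e -> exists2 r : K, 0 < r & forall h : K, h != 0 -> `|h| < r ->
    `|h^-1 * (f (h + z) - f z) - d| < e.
Proof.
have FP : ProperFilter (0 : K)^' by exact: Proper_dnbhs_numFieldType.
have E (h : K) : h^-1 *: (f (h *: (1 : K^o) + z) - f z) = h^-1 * (f (h + z) - f z).
  by rewrite [h *: _]mulr1.
have C : ((fun h : K => h^-1 *: (f (h *: (1 : K^o) + z) - f z)) @ (0 : K)^' --> d) <->
    forall e : K, 0 < e -> exists2 r : K, 0 < r & forall h : K, h != 0 -> `|h| < r ->
    `|h^-1 * (f (h + z) - f z) - d| < e.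
  split=> [H e e0|H].
    have := @cvgr_distC_lt _ _ _ _ _ _ _ H _ e0 => /(_ _)[r /= r0 Hr].
    exists r => // h h0 hr; rewrite -E; apply: Hr => //.
    by rewrite /ball /= sub0r normrN.
  apply/cvgrPdist_lt => e e0; have [r r0 Hr] := H e e0.
  exists r => //= h; rewrite /ball /= sub0r normrN => hr h0.
  by rewrite distrC E; exact: Hr.
split=> [[df dE]|H].
  by apply/C; rewrite -dE; move: df => /cvg_ex[l Hl]; rewrite /derive (cvg_lim _ Hl).
have {}H := (C.2 H); split; first by apply/cvg_ex; exists d.
exact: cvg_lim H.
Qed.

End DerivableEpsilon.

Section Bridge.
Variable R : realType.
Local Notation C := R[i].

Lemma gt0_complex (e : C) : 0 < e -> exists2 x : R, 0 < x & e = (x%:C)%C.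
Proof.
rewrite ltcE => /andP[/eqP i0 r0]; exists (complex.Re e) => //.
by case: e i0 r0 => p q /= -> _.
Qed.

Lemma ltc_normc (z : C) (x : R) : (`|z| < (x%:C)%C) = (normc z < x).
Proof. by rewrite normcE_norm ltcR. Qed.

Lemma derivable_hasd (f : Cplx R -> Cplx R) (z d : Cplx R) :
  (derivable f z 1 /\ 'D_1 f z = d) <-> hasd f z d.
Proof.
apply: (iff_trans (@derivable_epsP C f z d)); split=> [H e e0|H e].
  have e0C : 0 < (e%:C)%C :> C by rewrite ltcR.
  have [_ /gt0_complex[r r0 ->] Hr] := H _ e0C; exists r => // w wr /=.
  have [->|wz] := eqVneq w z; first by rewrite !subrr mulr0 subr0 normc0 mulr0.
  have wz0 : (w : C) - z != 0 by rewrite subr_eq0.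
  have := Hr ((w : C) - z) wz0; rewrite !ltc_normc subrK => /(_ wr) H1.
  have -> : (f w : C) - f z - (d : C) * ((w : C) - z) =
      (((w : C) - z)^-1 * ((f w : C) - f z) - d) * ((w : C) - z) by field.
  by rewrite normcM ler_wpM2r ?normc_ge0 // ltW.
move=> /gt0_complex[x x0 ->]; have x2 : 0 < x / 2 by lra.
have [r r0 Hr] := H _ x2; exists ((r%:C)%C) => [|h h0]; first by rewrite ltcR.
rewrite !ltc_normc => hr.
have := Hr ((h : C) + z); rewrite /= addrK => /(_ hr) H1.
have n0 : 0 < normc h by rewrite normc_gt0.
have -> : (h : C)^-1 * ((f ((h : C) + z) : C) - f z) - d =
   ((f ((h : C) + z) : C) - f z - (d : C) * h) / h by field.
by rewrite normcM normcV ltr_pdivrMr //; apply: le_lt_trans H1 _; nra.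
Qed.

Lemma unit_disk_normc (z : C) : unit_disk R z <-> normc z < 1.
Proof. by rewrite /unit_disk /= -ltc_normc. Qed.

Lemma disk_extE (f : unit_disk R -> Cplx R) (u : unit_disk R) :
  disk_ext f (set_val u) = f u.
Proof. by have := congr1 (@^~ u) (valLK (point : Cplx R) f). Qed.

Lemma disk_ext_in (f : unit_disk R -> Cplx R) (z : C) : normc z < 1 ->
  exists u : unit_disk R, set_val u = z /\ disk_ext f z = f u.
Proof.
move=> /unit_disk_normc z1; exists (SigSub (mem_set z1)); split => //.
exact: (@disk_extE f (SigSub (mem_set z1))).
Qed.

Lemma set_val_lt1 (u : unit_disk R) : normc (set_val u : C) < 1.
Proof. by apply/unit_disk_normc; exact: (set_valP u). Qed.

Lemma univalent_of_schlicht (t : hol_disk R) :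
  schlicht R t -> normalized_univalent (disk_ext (hol_fun t)).
Proof.
move=> [ti t0 td]; have th := set_valP t.
have n0 : normc (0 : C) < 1 by rewrite normc0.
split => //.
- move=> z /unit_disk_normc z1; exists ('D_1 (disk_ext (hol_fun t)) z).
  by apply/derivable_hasd; split => //; exact: th.
- move=> z w z1 w1.
  have [u [<- ->]] := disk_ext_in (hol_fun t) z1.
  by have [v [<- ->]] := disk_ext_in (hol_fun t) w1 => /ti ->.
- apply/derivable_hasd; split => //; apply: th; exact/unit_disk_normc.
Qed.

Lemma schlicht_of_univalent (g : C -> C) : normalized_univalent g ->
  exists2 t : hol_disk R, schlicht R t & forall u, hol_fun t u = g (set_val u).
Proof.
move=> [gh gi g0 gd]; pose f (u : unit_disk R) : Cplx R := g (set_val u).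
have fg z : normc z < 1 -> disk_ext f z = g z.
  by move=> z1; have [u [<- ->]] := disk_ext_in f z1.
have n0 : normc (0 : C) < 1 by rewrite normc0.
have ext z d : normc z < 1 -> hasd g z d -> hasd (disk_ext f) z d.
  move=> z1; apply: hasd_near_eq; exists (1 - normc z); first by lra.
  move=> w wz /=; rewrite fg //; have := ler_normcD (w - z) z; rewrite subrK; lra.
have fh : holomorphic_on_disk R f.
  move=> z /unit_disk_normc z1; have [d /(ext _ _ z1) Hd] := gh z z1.
  by have [] := (derivable_hasd (disk_ext f) z d).2 Hd.
exists (SigSub (mem_set fh) : hol_disk R) => //; split.
- move=> u v /= E; apply: val_inj; apply: gi; [exact: set_val_lt1|exact: set_val_lt1|exact: E].
- by rewrite -[RHS]g0; exact: fg.
- by have [] := (derivable_hasd (disk_ext f) 0 1).2 (ext _ _ n0 gd).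
Qed.

(** Otherwise points of K tending to the circle would cluster at a point of the
    disk.  This makes uniform convergence on disks of radius less than 1
    sufficient for convergence on compact sets. *)
Lemma compact_disk_radius (K : set (unit_disk R)) : compact K ->
  exists2 r : R, 0 < r < 1 & forall u, K u -> normc (set_val u : C) <= r.
Proof.
move=> Kc; apply: contrapT => nr.
have H (n : nat) : exists u, K u /\ 1 - n.+2%:R^-1 < normc (set_val u : C).
  apply: contrapT => nu; apply: nr; exists (1 - n.+2%:R^-1).
    have n1 : (n.+2%:R : R)^-1 < 1 by rewrite invf_lt1 // ltr1n.
    have n0 : 0 < (n.+2%:R : R)^-1 by rewrite invr_gt0.
    by rewrite subr_gt0 n1 gtrBl.
  by move=> u Ku; rewrite leNgt; apply/negP => ?; apply: nu; exists u.
have [u Hu] := choice H.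
have [|p [_ cp]] := Kc (u @ \oo) _.
  by exists 0%N => // n _ /=; have [] := Hu n.
have p1 := set_val_lt1 p.
pose e : R := (1 - normc (set_val p : C)) / 2; have e0 : 0 < e by rewrite /e; lra.
have [N HN] : exists N : nat, (N.+1%:R : R)^-1 < e.
  exists (Num.bound e^-1); rewrite invf_plt ?posrE //.
  apply: lt_trans (_ : (Num.bound e^-1)%:R < _); last by rewrite ltr_nat.
  by apply: archi_boundP; rewrite invr_ge0 ltW.
have P : (u @ \oo) [set v | exists2 n, (N <= n)%N & v = u n].
  by exists N => // n /= Nn; exists n.
have Q : nbhs p [set v | normc ((set_val v : C) - set_val p) < e].
  have c : {for p, continuous (set_val : unit_disk R -> Cplx R)}.
    exact: initial_continuous.
  have := c [set w : Cplx R | normc ((w : C) - set_val p) < e]; apply.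
  apply/nbhs_ballP; exists ((e%:C)%C); first by rewrite /= ltcR.
  by move=> w; rewrite /ball /= distrC ltc_normc.
have [_ [[n Nn ->] /= up]] := cp _ _ P Q.
have [_ un] := Hu n.
have H2 : (n.+2%:R : R)^-1 <= N.+1%:R^-1 by rewrite lef_pV2 ?posrE // ler_nat ltnS leqW.
have := lerB_normc (set_val (u n) : C) (set_val p).
rewrite /e in HN up; move: (n.+2%:R^-1) (N.+1%:R^-1) un H2 HN => s t; lra.
Qed.

End Bridge.

(** * Compactness *)

Section Convergence.
Variable R : realType.
Local Notation C := R[i].

Lemma hol_disk_cvg (F : set_system (hol_disk R)) (t : hol_disk R) : Filter F ->
  (forall s e : R, 0 < s < 1 -> 0 < e -> F [set t' : hol_disk R | forall z : C, normc z <= s ->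
     normc ((disk_ext (hol_fun t') z : C) - disk_ext (hol_fun t) z) < e]) ->
  F --> t.
Proof.
move=> FF H.
have main : (@set_val _ (holomorphic_on_disk R) @ F) -->
    (set_val t : {family compact, unit_disk R -> Cplx R}).
  apply/fam_cvgP => K Kc; have [s s01 Ks] := compact_disk_radius Kc.
  move=> P /uniform_nbhs[E [/= entE EP]].
  move: entE; rewrite -entourage_ballE => -[_ /gt0_complex[e e0 ->] eE].
  apply: (@filterS _ F FF _ _ _ (H s e s01 e0)) => t' /= Ht'; apply: EP => u Ku; apply: eE => /=.
  rewrite /ball /= distrC ltc_normc.
  by have := Ht' _ (Ks u Ku); rewrite !disk_extE.
move=> A /= [B [[D oD <-] /= Dt DA]].
apply: filterS DA _; apply: main; exact: open_nbhs_nbhs.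
Qed.

End Convergence.

Theorem proposition5p4 (R : realType) : compact (schlicht R).
Proof.
rewrite compact_ultra => F FU FS.
have FU' : F [set t | normalized_univalent (disk_ext (hol_fun t) : R[i] -> R[i])].
  by apply: filterS FS => t; exact: univalent_of_schlicht.
have [g gu Hg] := univalent_ultra_limit FU FU'.
have [t ts tg] := schlicht_of_univalent gu; exists t; split => //.
apply: hol_disk_cvg => s e s01 e0; apply: filterS (Hg s e s01 e0) => t' /= H z zs.
have z1 : normc z < 1 by lra.
have [u [uz ->]] := disk_ext_in (hol_fun t) z1.
by rewrite tg uz; exact: H.
Qed.
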